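(* Suppose that Assumptions A, B and C of the context hold, and let $\{x^k\}$ and $\{\lambda_{k+1}\}$ be generated by the algorithm sMBA described in the context. Let $M_{\mathcal B}$, $M_L$, $M_\lambda$ be the constants defined in the context, let $\psi^*$ be the optimal value of problem (P), and let $S_K=\sum_{k=\lceil K/2\rceil}^{K}\mu_k$. Then $G(x^k)\in\mathcal K$ for all $k\in\mathbb N_0$ and $$v^{k+1}:=\lambda_{k+1}\nabla h_{\mu_k}(G(x^{k+1}))\in\mathcal K^\circ\qquad\forall k\in\mathbb N_0.$$ Moreover, for any $K\in\mathbb N_0$ there exists an integer $\hat k\in[\lceil K/2\rceil,K]$ such that $$\rho_{\hat k+1}\le\sqrt{\bar M_1(\psi(x^0)-\psi^* )}\;S_K^{-1/2},$$ $$\|x^{\hat k+1}-x^{\hat k}\|\le\sqrt{2(\psi(x^0)-\psi^* )/\tau_1}\;\mu_{\lceil K/2\rceil}^{1/2}S_K^{-1/2},$$ $$-\langle G(x^{\hat k+1}),v^{\hat k+1}\rangle\le\alpha_3M_\lambda\,\mu_{\lceil K/2\rceil}+\bar M_2(\psi(x^0)-\psi^* )\,\mu_{\lceil K/2\rceil}S_K^{-1},$$ where $$\rho_k:=\mathrm{dist}\big(0,\ \partial P_1(x^k)-\partial P_2(x^{k-1})+\nabla f(x^k)+DG(x^k)^*v^k\big)\qquad\forall k\in\mathbb N,$$ $$\bar M_1:=16M_L^2\max\{\mu_0/\tau_1,\ M_\lambda/\tau_2\},\qquad \bar M_2:=(M_L+\mu_0L_GM_{\mathcal B})/\tau_2 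.$$
   Context: **Notation.** $\mathbb X,\mathbb Y$ are finite-dimensional real Hilbert spaces; $\mathbb N_0=\mathbb N\cup\{0\}$ with $\mathbb N=\{1,2,\dots\}$; $B(x,r)$ is the closed ball. For a cone $\mathcal K\subseteq\mathbb Y$, $\mathcal K^\circ=\{y:\langle y,w\rangle\le0\ \forall w\in\mathcal K\}$. A map is $L$-smooth if it is continuously differentiable with $L$-Lipschitz derivative; $DG(x)$ is the derivative of $G$, $DG(x)^*$ its adjoint, $\|DG(x)\|$ its operator norm. $\partial$ is the convex subdifferential. $\sigma_{\mathcal C}(y)=\sup_{u\in\mathcal C}\langle y,u\rangle$ is the support function. A base of a cone $\mathcal Q$ is a convex set $\mathcal D$ with $0\notin\mathrm{cl}(\mathcal D)$ and $\mathcal Q=\bigcup_{t\ge0}t\mathcal D$. **Problem (P).** Minimize $\psi(x):=f(x)+P_1(x)-P_2(x)$ over $x\in\mathbb X$ subject to $G(x)\in\mathcal K$. **Assumption A.** (i) $\mathcal K\subseteq\mathbb Y$ is a closed convex pointed cone with nonempty interior. (ii) $f:\mathbb X\to\mathbb R$ is $L_f$-smooth and $G:\mathbb X\to\mathbb Y$ is $L_G$-smooth, $L_f>0$, $L_G\ge0$. (iii) $P_1,P_2:\mathbb X\to\mathbb R$ are convex. (iv) There is $x^0\in\mathbb X$ with $G(x^0)\in\mathrm{int}(\mathcal K)$ such that $\Omega_0:=\{x:\psi(x)\le\psi(x^0),\ G(x)\in\mathcal K\}$ is bounded. (v) (Robinson's constraint qualification) $0\in\mathrm{int}(G(x)+DG(x)\mathbb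 X-\mathcal K)$ for all $x\in\Omega_0$. $\mathcal B$ is a fixed compact base of $\mathcal K^\circ$ (one exists), and $g_{\mathcal B}(x):=\sigma_{\mathcal B}(G(x))$. **Assumption B.** There are $\alpha_1\ge0$, $\alpha_2,\alpha_3,\alpha_4>0$ and a family $\{h_\mu\}_{\mu>0}$ of convex $C^1$ functions on $\mathbb Y$ such that for every $\mu>0$, $\nabla h_\mu$ is $(\alpha_1+\alpha_2/\mu)$-Lipschitz and $\sigma_{\mathcal B}(y)\le h_\mu(y)\le\sigma_{\mathcal B}(y)+\alpha_3\mu$ for all $y\in\mathbb Y$; and $h_{\mu_1}(y)\le h_{\mu_0}(y)-\alpha_4(\mu_0-\mu_1)$ for all $y\in\mathbb Y$ and $\mu_0>\mu_1>0$. Put $g_\mu(x):=h_\mu(G(x))$. **Assumption C.** The sequence $\{\mu_k\}_{k\in\mathbb N_0}$ used in the algorithm is positive, strictly decreasing, $\mu_k\to0$, and $S_K:=\sum_{k=\lceil K/2\rceil}^K\mu_k\to\infty$ as $K\to\infty$. **Algorithm sMBA.** Input: $\tau_1,\tau_2>0$, $\hat L\ge\check L>0$, the point $x^0$ of Assumption A(iv), the family $\{h_\mu\}$. Step 1: find $\mu_0>0$ with $g_{\mu_0}(x^0)<0$; set $k=0$. Step 2: choose $\xi^k\in\partial P_2(x^k)$ and $L_f^{k,0},L_g^{k,0}\in[\check L,\hat L]$; set $i=j=0$. Step 3: set $L_f^{k,i}=2^iL_f^{k,0}$, $L_g^{k,j}=2^jL_g^{k,0}$; let $x^{k,i,j}$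 be the unique solution, and $\lambda_{k,i,j}\ge0$ a Lagrange multiplier, of the problem of minimizing $\psi_{k,i}(x):=P_1(x)+\langle\nabla f(x^k)-\xi^k,x-x^k\rangle+\frac{L_f^{k,i}}2\|x-x^k\|^2$ subject to $g_{k,j}(x):=g_{\mu_k}(x^k)+\langle\nabla g_{\mu_k}(x^k),x-x^k\rangle+\frac{L_g^{k,j}}{2\mu_k}\|x-x^k\|^2\le0$. Step 4: if $g_{\mu_k}(x^{k,i,j})\le0$ and $\psi(x^{k,i,j})\le\psi(x^k)-\frac{\tau_1\mu_k+\tau_2\lambda_{k,i,j}}{2\mu_k}\|x^{k,i,j}-x^k\|^2$, set $i_k=i$, $j_k=j$ and go to Step 5; else if $g_{\mu_k}(x^{k,i,j})>0$, set $j\leftarrow j+1$ and go to Step 3; else set $i\leftarrow i+1$, $j\leftarrow j+1$ and go to Step 3. Step 5: set $x^{k+1}=x^{k,i_k,j_k}$, $\lambda_{k+1}=\lambda_{k,i_k,j_k}$, $L_f^k=L_f^{k,i_k}$, $L_g^k=L_g^{k,j_k}$; choose $\mu_{k+1}\in(0,\mu_k)$; $k\leftarrow k+1$; go to Step 2. **Constants.** $M_{\mathcal B}=\sup_{u\in\mathcal B}\|u\|$; $M_G=\sup_{x\in\Omega_0}\|DG(x)\|$; $g^*_{\mathcal B}=\inf_{x\in\Omega_0}g_{\mathcal B}(x)$; $M_R=\sqrt{\mu_0^2\check L^{-2}M_G^2M_{\mathcal B}^2-2\mu_0\check L^{-1}g^*_{\mathcal B}}+\mu_0\check L^{-1}M_GM_{\mathcal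 B}$; $\hat\Omega_0=\Omega_0+B(0,M_R)$; $\hat M_G=\sup\{\|DG(x)\|:x\in\mathrm{conv}(\hat\Omega_0)\}$; $L_\mu=M_{\mathcal B}L_G+\alpha_1\hat M_G^2+\alpha_2\hat M_G^2/\mu$; $M_L=\hat L\max\{2,2(L_f+\tau_1)/\check L\}\max\{2,2\tau_2/\check L,2\mu_0L_{\mu_0}/\check L\}$. $M_f=\sup_{x\in\Omega_0}\|\nabla f(x)\|$; $M_{P_1}=\sup_{x\in\hat\Omega_0}\{\|\zeta\|:\zeta\in\partial P_1(x)\}$; $M_{P_2}=\sup_{x\in\Omega_0}\{\|\xi\|:\xi\in\partial P_2(x)\}$. $\eta>0$ is a constant (one exists) such that for no $(x,u)\in\Omega_0\times\mathcal B$ do both $\|DG(x)^*u\|^2\le\eta$ and $-\langle u,G(x)\rangle\le\eta$ hold. $\bar t$ is the first positive integer with $\mu_{\bar t}<\eta/(2\alpha_3)$; $c_0=\min\{\mu_{t-1}/\mu_t-1:t=1,\dots,\bar t\}$; $\bar\eta=\sqrt{\min\{\eta,\,2\alpha_3\check L,\,-2\mu_0^{-1}\check Lg_{\mu_0}(x^0),\,2c_0\alpha_4\check L\}}$; $M_\lambda=\frac{M_f+M_{P_1}+M_{P_2}}{\bar\eta}+\frac{M_LM_G^2M_{\mathcal B}^2\mu_0}{2\check L\bar\eta^2}$. *)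

(* Defs.v *)
From HB Require Import structures.
From mathcomp Require Import all_boot all_order all_algebra.
From mathcomp Require Import all_classical all_reals all_analysis.

Set Implicit Arguments.
Unset Strict Implicit.
Unset Printing Implicit Defensive.

Import Order.TTheory GRing.Theory Num.Theory.
Import numFieldNormedType.Exports.

Local Open Scope classical_set_scope.
Local Open Scope ring_scope.

(* Finite-dimensional real Hilbert spaces: the topology is that of the norm of
   the normedModType, and [inner_norm] makes this norm the Hilbert norm.
   Completeness is automatic in finite dimension. *)
HB.mixin Record NormedModule_hasInner (R : realType) V
    of NormedModule R V := {
  inner : V -> V -> R ;
  innerC : forall x y, inner x y = inner y x ;
  inner_linear : forall (a : R) (x y z : V),
    inner (a *: x + y) z = a * inner x z + inner y z ;
  inner_norm : forall x : V, inner x x = `|x| ^+ 2 }.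

#[short(type="euclidType")]
HB.structure Definition Euclid (R : realType) :=
  { V of NormedModule R V & Vector R V & NormedModule_hasInner R V }.

Section hilbert.
Context {R : realType} {X Y : euclidType R}.

Definition opnorm (W : normedModType R) (A : X -> W) : R :=
  sup [set `|A v| | v in closed_ball_ Num.norm 0 1].

(* The Hilbert adjoint: [adjoint A u] is the w with <w, v> = <u, A v>. *)
Definition adjoint (A : X -> Y) (u : Y) : X :=
  xget 0 [set w | forall v, inner w v = inner u (A v)].

(* The Riesz representative of the derivative. *)
Definition grad (f : X -> R) (x : X) : X :=
  xget 0 [set w | forall v, inner w v = 'd (f : X -> R^o) x v].

Definition subdiff (f : X -> R) (x : X) : set X :=
  [set xi | forall y, f x + inner xi (y - x) <= f y].

(* Continuity of the derivative follows from its Lipschitz continuity. *)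
Definition smooth (W : normedModType R) (L : R) (F : X -> W) : Prop :=
  (forall x, differentiable F x) /\
  (forall x y, opnorm ('d F x \- 'd F y) <= L * `|x - y|).

Definition conv_hull (A : set X) : set X :=
  \bigcap_(C in [set C : set X | convex_set C /\ A `<=` C]) C.

Definition polar (Q : set X) : set X :=
  [set y | forall w, Q w -> inner y w <= 0].

Definition support_fun (C : set X) (y : X) : R := sup [set inner y u | u in C].

Definition pointed_closed_convex_cone (Q : set X) : Prop :=
  [/\ closed Q, convex_set Q,
      (forall t y, 0 <= t -> Q y -> Q (t *: y)) &
      Q `&` [set - y | y in Q] = [set 0]].

Definition cone_base (D Q : set X) : Prop :=
  [/\ convex_set D, ~ closure D 0 &
      Q = \bigcup_(t in [set t : R | 0 <= t]) [set t *: u | u in D]].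

Definition argmin (C : set X) (phi : X -> R) : set X :=
  [set x | C x /\ forall y, C y -> phi x <= phi y].

(* Lagrange multiplier of the convex problem min phi(x) s.t. g(x) <= 0 at a solution x:
   the KKT conditions, with stationarity 0 \in d(phi + lam g)(x). *)
Definition lagrange_multiplier (phi g : X -> R) (x : X) (lam : R) : Prop :=
  [/\ 0 <= lam, lam * g x = 0 & subdiff (fun y => phi y + lam * g y) x 0].

End hilbert.

Record problem (R : realType) (X Y : euclidType R) := Problem {
  obj : X -> R ;
  P1 : X -> R ;
  P2 : X -> R ;
  cstr : X -> Y ;
  Kcone : set Y ;
  Lf : R ;
  LG : R ;
  start : X }.

Record smoothing (R : realType) (Y : euclidType R) := Smoothing {
  base : set Y ;
  hfam : R -> Y -> R ;
  alpha1 : R ;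
  alpha2 : R ;
  alpha3 : R ;
  alpha4 : R }.

Record parameters (R : realType) := Params {
  tau1 : R ;
  tau2 : R ;
  Lhat : R ;
  Lcheck : R }.

(* All the quantities produced by a run: [iterate k] is x^k, [mult k.+1] is
   lambda_{k+1} ([mult 0] is irrelevant), [trial k i j] and [trial_mult k i j]
   are x^{k,i,j} and lambda_{k,i,j} (irrelevant at the pairs (i, j) that the
   backtracking does not reach), [Lf0 k] and [Lg0 k] are L_f^{k,0} and
   L_g^{k,0}, and [ik k], [jk k] are i_k and j_k. *)
Record history (R : realType) (X : euclidType R) := History {
  iterate : nat -> X ;
  mult : nat -> R ;
  mu : nat -> R ;
  xi : nat -> X ;
  Lf0 : nat -> R ;
  Lg0 : nat -> R ;
  trial : nat -> nat -> nat -> X ;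
  trial_mult : nat -> nat -> nat -> R ;
  ik : nat -> nat ;
  jk : nat -> nat }.

Section problem_defs.
Context {R : realType} {X Y : euclidType R} (p : problem X Y).

Definition psi (x : X) : R := obj p x + P1 p x - P2 p x.

Definition feasible : set X := [set x | Kcone p (cstr p x)].

Definition psi_opt : R := inf [set psi x | x in feasible].

Definition Omega0 : set X := [set x | psi x <= psi (start p) /\ feasible x].

Record assumptionA : Prop := AssumptionA {
  A_cone : pointed_closed_convex_cone (Kcone p) ;
  A_cone_interior : (Kcone p)° !=set0 ;
  A_Lf_gt0 : 0 < Lf p ;
  A_LG_ge0 : 0 <= LG p ;
  A_obj_smooth : smooth (Lf p) (obj p : X -> R^o) ;
  A_cstr_smooth : smooth (LG p) (cstr p) ;
  A_P1_convex : convex_function [set: X] (P1 p) ;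
  A_P2_convex : convex_function [set: X] (P2 p) ;
  A_slater : (Kcone p)° (cstr p (start p)) ;
  A_bounded : bounded_set Omega0 ;
  A_robinson : forall x, Omega0 x ->
    [set cstr p x + 'd (cstr p) x d - y | d in [set: X] & y in Kcone p]° 0 }.

End problem_defs.

Section algorithm.
Context {R : realType} {X Y : euclidType R}.
Context (p : problem X Y) (s : smoothing Y) (q : parameters R).
Context (t : history X).

Definition g_base (x : X) : R := support_fun (base s) (cstr p x).

Definition g_smooth (m : R) (x : X) : R := hfam s m (cstr p x).

Record assumptionB : Prop := AssumptionB {
  B_base_compact : compact (base s) ;
  B_base : cone_base (base s) (polar (Kcone p)) ;
  B_alpha1 : 0 <= alpha1 s ;
  B_alpha2 : 0 < alpha2 s ;
  B_alpha3 : 0 < alpha3 s ;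
  B_alpha4 : 0 < alpha4 s ;
  B_convex : forall m : R, 0 < m -> convex_function [set: Y] (hfam s m) ;
  (* The gradient, being Lipschitz, is continuous. *)
  B_diff : forall (m : R) y, 0 < m -> differentiable (hfam s m : Y -> R^o) y ;
  B_lip : forall m : R, 0 < m ->
    (alpha1 s + alpha2 s / m).-lipschitz (grad (hfam s m)) ;
  B_approx : forall (m : R) y, 0 < m ->
    support_fun (base s) y <= hfam s m y <= support_fun (base s) y + alpha3 s * m ;
  B_decr : forall (m0 m1 : R) y, 0 < m1 -> m1 < m0 ->
    hfam s m1 y <= hfam s m0 y - alpha4 s * (m0 - m1) }.

(* [uphalf K] is the ceiling of K/2. *)
Definition muS (K : nat) : R := \sum_(uphalf K <= k < K.+1) mu t k.

Record assumptionC : Prop := AssumptionC {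
  C_pos : forall k, 0 < mu t k ;
  C_decr : forall k, mu t k.+1 < mu t k ;
  C_cvg0 : mu t k @[k --> \oo] --> (0 : R) ;
  C_sum : muS K @[K --> \oo] --> +oo }.

Definition psi_model (k i : nat) (x : X) : R :=
  P1 p x + inner (grad (obj p) (iterate t k) - xi t k) (x - iterate t k)
  + 2 ^+ i * Lf0 t k / 2 * `|x - iterate t k| ^+ 2.

Definition g_model (k j : nat) (x : X) : R :=
  g_smooth (mu t k) (iterate t k)
  + inner (grad (g_smooth (mu t k)) (iterate t k)) (x - iterate t k)
  + 2 ^+ j * Lg0 t k / (2 * mu t k) * `|x - iterate t k| ^+ 2.

Definition accepted (k i j : nat) : Prop :=
  g_smooth (mu t k) (trial t k i j) <= 0 /\
  psi p (trial t k i j) <= psi p (iterate t k)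
    - (tau1 q * mu t k + tau2 q * trial_mult t k i j) / (2 * mu t k)
      * `|trial t k i j - iterate t k| ^+ 2.

(* The pairs (i, j) tested by the backtracking at iteration k. *)
Inductive reached (k : nat) : nat -> nat -> Prop :=
| reached_init : reached k 0 0
| reached_infeasible i j : reached k i j ->
    0 < g_smooth (mu t k) (trial t k i j) -> reached k i j.+1
| reached_no_descent i j : reached k i j ->
    g_smooth (mu t k) (trial t k i j) <= 0 -> ~ accepted k i j ->
    reached k i.+1 j.+1.

Record sMBA : Prop := SMBA {
  run_tau1 : 0 < tau1 q ;
  run_tau2 : 0 < tau2 q ;
  run_Lcheck : 0 < Lcheck q ;
  run_Lhat : Lcheck q <= Lhat q ;
  run_start : iterate t 0 = start p ;
  run_mu0 : 0 < mu t 0 ;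
  run_g0 : g_smooth (mu t 0) (start p) < 0 ;
  run_xi : forall k, subdiff (P2 p) (iterate t k) (xi t k) ;
  run_Lf0 : forall k, Lcheck q <= Lf0 t k <= Lhat q ;
  run_Lg0 : forall k, Lcheck q <= Lg0 t k <= Lhat q ;
  run_trial : forall k i j, reached k i j ->
    unique (argmin [set x | g_model k j x <= 0] (psi_model k i))
           (trial t k i j) ;
  run_trial_mult : forall k i j, reached k i j ->
    lagrange_multiplier (psi_model k i) (g_model k j)
      (trial t k i j) (trial_mult t k i j) ;
  run_reached : forall k, reached k (ik t k) (jk t k) ;
  run_accepted : forall k, accepted k (ik t k) (jk t k) ;
  run_iter : forall k, iterate t k.+1 = trial t k (ik t k) (jk t k) ;
  run_mult : forall k, mult t k.+1 = trial_mult t k (ik t k) (jk t k) ;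
  run_mu : forall k, 0 < mu t k.+1 < mu t k }.

Definition M_B : R := sup [set `|u| | u in base s].

Definition M_G : R := sup [set opnorm ('d (cstr p) x) | x in Omega0 p].

Definition g_star : R := inf [set g_base x | x in Omega0 p].

Definition M_R : R :=
  Num.sqrt (mu t 0 ^+ 2 * (Lcheck q)^-2 * M_G ^+ 2 * M_B ^+ 2
            - 2 * mu t 0 * (Lcheck q)^-1 * g_star)
  + mu t 0 * (Lcheck q)^-1 * M_G * M_B.

Definition Omega0_hat : set X :=
  [set x + y | x in Omega0 p & y in closed_ball_ Num.norm 0 M_R].

Definition M_G_hat : R :=
  sup [set opnorm ('d (cstr p) x) | x in conv_hull Omega0_hat].

Definition L_mu (m : R) : R :=
  M_B * LG p + alpha1 s * M_G_hat ^+ 2 + alpha2 s * M_G_hat ^+ 2 / m.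

Definition M_L : R :=
  Lhat q * Num.max 2 (2 * (Lf p + tau1 q) / Lcheck q)
  * Num.max 2 (Num.max (2 * tau2 q / Lcheck q)
                       (2 * mu t 0 * L_mu (mu t 0) / Lcheck q)).

Definition M_f : R := sup [set `|grad (obj p) x| | x in Omega0 p].

Definition M_P1 : R :=
  sup [set `|z| | z in \bigcup_(x in Omega0_hat) subdiff (P1 p) x].

Definition M_P2 : R :=
  sup [set `|z| | z in \bigcup_(x in Omega0 p) subdiff (P2 p) x].

Definition eta_admissible (eta : R) : Prop :=
  0 < eta /\
  ~ (exists x u, [/\ Omega0 p x, base s u,
       `|adjoint ('d (cstr p) x) u| ^+ 2 <= eta & - inner u (cstr p x) <= eta]).

Definition is_tbar (eta : R) (tb : nat) : Prop :=
  [/\ (0 < tb)%N, mu t tb < eta / (2 * alpha3 s) &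
      forall n, (0 < n)%N -> mu t n < eta / (2 * alpha3 s) -> (tb <= n)%N].

(* The minimum over 1 <= n <= tb; the default value of the iterated minimum is
   its term for n = 1. *)
Definition c_0 (tb : nat) : R :=
  \big[Num.min/mu t 0 / mu t 1 - 1]_(1 <= n < tb.+1) (mu t n.-1 / mu t n - 1).

Definition eta_bar (eta : R) (tb : nat) : R :=
  Num.sqrt (Num.min eta (Num.min (2 * alpha3 s * Lcheck q)
    (Num.min (- 2 * (mu t 0)^-1 * Lcheck q * g_smooth (mu t 0) (start p))
             (2 * c_0 tb * alpha4 s * Lcheck q)))).

Definition M_lambda (eta : R) (tb : nat) : R :=
  (M_f + M_P1 + M_P2) / eta_bar eta tb
  + M_L * M_G ^+ 2 * M_B ^+ 2 * mu t 0 / (2 * Lcheck q * eta_bar eta tb ^+ 2).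

(* [vdual k] and [rho k] are meaningful for k >= 1. *)
Definition vdual (k : nat) : Y :=
  mult t k *: grad (hfam s (mu t k.-1)) (cstr p (iterate t k)).

(* Extended-real valued, so that the distance to an empty set would be +oo. *)
Definition rho (k : nat) : \bar R :=
  edist_inf [set z1 - z2 + grad (obj p) (iterate t k)
               + adjoint ('d (cstr p) (iterate t k)) (vdual k)
             | z1 in subdiff (P1 p) (iterate t k)
             & z2 in subdiff (P2 p) (iterate t k.-1)] 0.

Definition M1_bar (eta : R) (tb : nat) : R :=
  16 * M_L ^+ 2 * Num.max (mu t 0 / tau1 q) (M_lambda eta tb / tau2 q).

Definition M2_bar : R := (M_L + mu t 0 * LG p * M_B) / tau2 q.

End algorithm.

(* Main.v *)
(* Proof idea. The gradients of the smoothed functions [hfam s m] lie in the compact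
   base, so [g_mu = h_mu o G] is [L_mu]-smooth near [Omega0] and all constants are
   finite. The quadratic models then majorize once the step constants are large,
   which bounds the backtracking by [M_L]. The number [eta_bar] bounds from below the
   gradient of the constraint model at a point where its multiplier is positive, and
   this gives [M_lambda]. Telescoping the sufficient decrease of [psi] over
   [uphalf K .. K] with weights [mu_k] selects an index where
   (tau1 mu + tau2 lambda) |d|^2 / (2 mu^2) <= (psi(x0) - psi_opt) / S_K, and the three
   estimates are read off the optimality conditions of the subproblem at that index. *)
From HB Require Import structures.
Require Import Defs.
From mathcomp Require Import all_boot all_order all_algebra.
From mathcomp Require Import all_classical all_reals all_analysis.
From mathcomp Require Import ring lra.
Import Order.TTheory GRing.Theory Num.Theory.
Import numFieldNormedType.Exports.
Local Open Scope classical_set_scope.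
Local Open Scope ring_scope.

Set Implicit Arguments.
Unset Strict Implicit.
Unset Printing Implicit Defensive.

(** * Euclidean spaces *)

Section euclidean.
Context {R : realType} {V : euclidType R}.
Implicit Types (x y z u v w : V) (a r : R) (C : set V).

(** The obstacle is that the gradient of [g_mu] has a Lipschitz constant growing like [1 / mu].
    Three choices absorb it. The model curvature is [Lg / mu], so majorization asks only for
    [mu * L_mu <= Lg], and since [mu * L_mu] is nondecreasing in [mu], one threshold at [mu 0]
    serves every iteration. The selected index bounds the weighted squared step by a multiple of
    [mu ^ 2], which cancels the [1 / mu] of the residual. Finally, [g_mu] at the new iterate is
    bounded below through convexity of [h_mu] and smoothness of [G], with a constant free of
    [1 / mu]. [L_mu] is valid only along segments in the convex hull of [Omega0_hat], so every
    tested step must first be bounded by [M_R]; the model constraint alone gives this, before any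
    acceptance. The two maxima in [M_L] multiply because a rejected descent test doubles both step
    constants. *)

Lemma innerDl x y z : inner (x + y) z = inner x z + inner y z.
Proof. by rewrite -[x in LHS]scale1r inner_linear mul1r. Qed.

Lemma inner0l z : inner 0 z = 0 :> R.
Proof. by apply: (addrI (inner 0 z)); rewrite -innerDl !addr0. Qed.

Lemma innerZl a x z : inner (a *: x) z = a * inner x z.
Proof. by rewrite -[a *: x]addr0 inner_linear inner0l addr0. Qed.

Lemma innerNl x z : inner (- x) z = - inner x z.
Proof. by rewrite -scaleN1r innerZl mulN1r. Qed.

Lemma innerBl x y z : inner (x - y) z = inner x z - inner y z.
Proof. by rewrite innerDl innerNl. Qed.

Lemma inner0r z : inner z 0 = 0 :> R.
Proof. by rewrite innerC inner0l. Qed.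

Lemma innerDr x y z : inner z (x + y) = inner z x + inner z y.
Proof. by rewrite ![inner z _]innerC innerDl. Qed.

Lemma innerZr a x z : inner z (a *: x) = a * inner z x.
Proof. by rewrite ![inner z _]innerC innerZl. Qed.

Lemma innerNr x z : inner z (- x) = - inner z x.
Proof. by rewrite ![inner z _]innerC innerNl. Qed.

Lemma innerBr x y z : inner z (x - y) = inner z x - inner z y.
Proof. by rewrite innerDr innerNr. Qed.

Definition innerE := (innerDl, innerDr, innerBl, innerBr, innerZl, innerZr,
  innerNl, innerNr, inner0l, inner0r).

Lemma normD_sqr x y : `|x + y| ^+ 2 = `|x| ^+ 2 + 2 * inner x y + `|y| ^+ 2.
Proof. rewrite -!inner_norm !innerE [inner y x]innerC; ring. Qed.

Lemma normB_sqr x y : `|x - y| ^+ 2 = `|x| ^+ 2 - 2 * inner x y + `|y| ^+ 2.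
Proof. by rewrite normD_sqr normrN innerNr mulrN. Qed.

Lemma inner_eq x y : (forall v, inner x v = inner y v) -> x = y.
Proof.
move=> e; apply/eqP; rewrite -subr_eq0 -normr_eq0 -sqrf_eq0 -inner_norm.
by rewrite innerBl !e subrr.
Qed.

Lemma inner_le x y : inner x y <= `|x| * `|y|.
Proof.
have [->|x0] := eqVneq x 0; first by rewrite inner0l normr0 mul0r.
have [->|y0] := eqVneq y 0; first by rewrite inner0r normr0 mulr0.
have nx : 0 < `|x| by rewrite normr_gt0.
have ny : 0 < `|y| by rewrite normr_gt0.
have := sqr_ge0 `| `|y| *: x - `|x| *: y|.
rewrite normB_sqr !normrZ !normr_id innerZl innerZr.
have -> : (`|y| * `|x|) ^+ 2 - 2 * (`|y| * (`|x| * inner x y))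
   + (`|x| * `|y|) ^+ 2 = 2 * (`|x| * `|y|) * (`|x| * `|y| - inner x y) by ring.
by rewrite pmulr_rge0 ?subr_ge0// !mulr_gt0.
Qed.

Lemma inner_ge x y : - (`|x| * `|y|) <= inner x y.
Proof. by have := inner_le (- x) y; rewrite innerNl normrN lerNl. Qed.

Lemma norm_inner_le x y : `|inner x y| <= `|x| * `|y|.
Proof. by rewrite ler_norml inner_ge inner_le. Qed.

Lemma norm_le_inner x c : 0 <= c -> (forall v, inner x v <= c * `|v|) -> `|x| <= c.
Proof.
move=> c0 /(_ x); rewrite inner_norm expr2.
have [->//|x0] := eqVneq `|x| 0.
by rewrite ler_pM2r// lt_neqAle eq_sym x0/=.
Qed.

(* [w |-> inner w] is injective into ['Hom(V, R^o)], which has the dimension of [V]. *)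
Lemma riesz (l : V -> R) : linear (l : V -> R^o) -> exists w, forall v, inner w v = l v.
Proof.
move=> lin.
have inlin w : linear (inner w : V -> R^o).
  by move=> a u v; rewrite innerDr innerZr.
pose lM := GRing.isLinear.Build _ _ _ _ (l : V -> R^o) lin.
pose lL : {linear V -> R^o} := HB.pack (l : V -> R^o) lM.
pose iM w := GRing.isLinear.Build _ _ _ _ (inner w : V -> R^o) (inlin w).
pose iL w : {linear V -> R^o} := HB.pack (inner w : V -> R^o) (iM w).
pose T w : 'Hom(V, R^o) := linfun (iL w).
have Tlin : linear T.
  by move=> a u v; apply/lfunP => z; rewrite lfunE/= !lfunE/= scale_lfunE !lfunE/= inner_linear.
pose TM := GRing.isLinear.Build _ _ _ _ T Tlin.
pose TL : {linear V -> 'Hom(V, R^o)} := HB.pack T TM.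
pose f := linfun TL.
have kf : lker f == 0%VS.
  apply/lker0P => u v; rewrite !lfunE/= => /lfunP e.
  by apply: inner_eq => z; have := e z; rewrite !lfunE.
have : limg f = fullv.
  apply/eqP; rewrite eqEdim subvf/= (limg_dim_eq _); last first.
    by rewrite (eqP kf) capv0.
  by rewrite !dimvf /dim/= muln1.
move=> /vspaceP /(_ (linfun lL)); rewrite memvf => /memv_imgP[w _ e].
exists w => v; rewrite -[RHS](lfunE lL v) e -[LHS](lfunE (iL w) v).
by congr (fun_of_lfun _ v); rewrite [RHS](lfunE TL w).
Qed.

End euclidean.

(** * Compactness, projections and polarity in finite dimension *)

Section euclidean_finite_dim.
Context {R : realType} {V : euclidType R}.
Implicit Types (x y z u v w : V) (a r : R) (C : set V).

(** The coordinate functionals of a basis are written as inner products, so that Cauchy-Schwarz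
    bounds each coordinate by the norm. *)
Lemma coordinates : exists (n : nat) (e w : 'I_n -> V),
  forall v, v = \sum_i inner (w i) v *: e i.
Proof.
pose b := vbasis (fullv : {vspace V}).
have /choice[w wE] i : exists w, forall v, inner w v = coord b i v.
  by apply: riesz => c u v; rewrite linearP.
exists (\dim (fullv : {vspace V})), (fun i => b`_i), w => v.
rewrite {1}(coord_vbasis (memvf v)).
by apply: eq_bigr => i _; rewrite wE.
Qed.

Lemma linear_bounded (W : normedModType R) (f : V -> W) : linear f ->
  exists c, 0 <= c /\ forall v, `|f v| <= c * `|v|.
Proof.
move=> flin.
pose fM := GRing.isLinear.Build _ _ _ _ f flin.
pose fL : {linear V -> W} := HB.pack f fM.
have [n [e [w ew]]] := coordinates.
exists (\sum_i `|w i| * `|f (e i)|); split.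
  by apply: sumr_ge0 => i _; rewrite mulr_ge0.
move=> v; rewrite {1}[v]ew -[f]/(fL : V -> W) linear_sum/=.
rewrite (le_trans (ler_norm_sum _ _ _))// mulr_suml ler_sum// => i _.
rewrite -[f]/(fL : V -> W) linearZ/= normrZ mulrAC ler_wpM2r//.
exact: norm_inner_le.
Qed.

Lemma bounded_set_norm_le C : bounded_set C -> exists M, 0 <= M /\ forall x, C x -> `|x| <= M.
Proof.
move=> [M [Mreal CM]]; exists (`|M| + 1); split; first by rewrite addr_ge0.
by move=> x Cx; apply: (CM (`|M| + 1)) => //; rewrite ltr_pwDr// ler_norm.
Qed.

(* [C] is the continuous image of a compact set of coordinate vectors. *)
Lemma closed_bounded_compact C M :
  (forall x, C x -> `|x| <= M) -> closed C -> compact C.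
Proof.
move=> CM clC; have [n [e [w ew]]] := coordinates.
pose f (r : 'rV[R]_n) : V := \sum_i r ord0 i *: e i.
have fcont : continuous f.
  move=> r; apply: (@cvg_big _ _ +%R 0 xpredT add_continuous _ (nbhs r)).
  by move=> i _; apply: cvgZr_tmp; exact: coord_continuous.
pose N := \sum_i `|w i| * `|M|.
pose D := f @^-1` C `&` [set r : 'rV[R]_n | `|r| <= N].
have -> : C = f @` D.
  apply/seteqP; split => [x Cx|x [r [Cr _]] <-//].
  have fx : f (\row_i inner (w i) x) = x.
    by rewrite {2}[x]ew; apply: eq_bigr => i _; rewrite mxE.
  exists (\row_i inner (w i) x) => //; split; first by rewrite /= fx.
  rewrite /= [leLHS]/Num.norm/= mx_normrE; apply/bigmax_leP; split => /=.
    by apply: sumr_ge0 => i _; rewrite mulr_ge0.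
  move=> [i j] _ /=; rewrite mxE (le_trans (norm_inner_le _ _))//.
  rewrite /N (bigD1 j)//= ler_wpDr//.
    by apply: sumr_ge0 => k _; rewrite mulr_ge0.
  by rewrite ler_wpM2l// (le_trans (CM _ Cx))// ler_norm.
apply: continuous_compact; first exact: continuous_subspaceT.
apply: bounded_closed_compact.
  exists N; split; first exact: num_real.
  by move=> K NK r [_ /= rN]; rewrite (le_trans rN)// ltW.
apply: closedI.
  by apply: closed_comp => // r _; exact: fcont.
apply: (@closed_comp _ _ (fun r : 'rV[R]_n => `|r|) [set x : R | x <= N]).
  by move=> r _; exact: norm_continuous.
exact: closed_le.
Qed.

Lemma convex_setP C x y a : convex_set C -> C x -> C y -> 0 <= a -> a <= 1 ->
  C (a *: x + (1 - a) *: y).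
Proof.
move=> cvxC Cx Cy a0 a1; have := cvxC x y (Itv01 a0 a1).
by rewrite !inE; apply.
Qed.

Lemma convex_functionP (f : V -> R) x y a : convex_function [set: V] f ->
  0 <= a -> a <= 1 -> f (a *: x + (1 - a) *: y) <= a * f x + (1 - a) * f y.
Proof.
move=> cvxf a0 a1; have := cvxf (Itv01 a0 a1) x y.
by rewrite !inE; apply.
Qed.

Lemma projection C y : closed C -> convex_set C -> C !=set0 ->
  exists2 c, C c & forall z, C z -> inner (y - c) (z - c) <= 0.
Proof.
move=> clC cvxC [c0 Cc0].
(* [C] may be unbounded; cutting it at the distance of one known point makes it compact without
   losing any minimizer. *)
pose D := C `&` [set z | `|y - z| <= `|y - c0|].
have dcont : continuous (fun z => `|y - z|).
  move=> z; apply: (@cvg_norm _ _ _ (nbhs z)).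
  by apply: cvgB; [exact: cvg_cst|exact: cvg_id].
have cD : compact D.
  apply: (@closed_bounded_compact _ (`|y| + `|y - c0|)).
    move=> z [_ /= zy]; rewrite -[z](subKr y) (le_trans (ler_normB _ _))//.
    by rewrite lerD2l.
  apply: closedI => //.
  apply: (@closed_comp _ _ (fun z => `|y - z|) [set x : R | x <= `|y - c0|]).
    by move=> z _; exact: dcont.
  exact: closed_le.
have D0 : D !=set0 by exists c0; split => /=.
have [|c] := compact_EVT_min (f := fun z => `|y - z|) D0 cD.
  exact: continuous_subspaceT.
rewrite inE => -[Cc /= cD'] cmin.
have {}cmin z : C z -> `|y - c| <= `|y - z|.
  move=> Cz; have [zD|/ltW zD] := leP `|y - z| `|y - c0|.
    by apply: cmin; rewrite inE.
  exact: le_trans cD' zD.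
exists c => // z Cz; rewrite leNgt; apply/negP => ip.
have n2 : 0 < `|z - c| ^+ 2.
  rewrite exprn_gt0// normr_gt0; apply: contraTneq ip => ->.
  by rewrite inner0r ltxx.
set i := inner _ _ in ip; set n := `|z - c| ^+ 2 in n2.
(* Moving from [c] by a fraction [a] towards [z] changes the squared distance to [y] by
   [a * (a * n - 2 * i)], negative once [a * n <= i]; the cap at 1 stays on the segment. *)
pose a := Num.min 1 (i / n).
have a0 : 0 < a by rewrite lt_min ltr01 divr_gt0.
have a1 : a <= 1 by rewrite ge_min lexx.
have an : a * n <= i by rewrite -ler_pdivlMr// ge_min lexx orbT.
have := cmin _ (convex_setP cvxC Cz Cc (ltW a0) a1).
have -> : y - (a *: z + (1 - a) *: c) = (y - c) - a *: (z - c).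
  by rewrite scalerBl scale1r scalerBr !opprD !opprK !addrA [y - _ - c]addrAC.
rewrite -ler_sqr ?nnegrE// (normB_sqr (y - c)) innerZr -/i normrZ exprMn -/n.
rewrite real_normK ?num_real//.
have : a * (2 * i - a * n) > 0 by rewrite mulr_gt0//; lra.
by lra.
Qed.

Lemma support_has_sup C y : compact C -> C !=set0 -> has_sup [set inner y u | u in C].
Proof.
move=> /compact_bounded/bounded_set_norm_le[M [M0 CM]] [c0 Cc0]; split.
  by exists (inner y c0), c0.
exists (`|y| * M) => _ [u Cu <-].
by rewrite (le_trans (inner_le _ _))// ler_wpM2l// CM.
Qed.

Lemma support_fun_ge C y u : compact C -> C u -> inner y u <= support_fun C y.
Proof.
move=> cC Cu; apply: ub_le_sup; last by exists u.
by have [] := support_has_sup y cC (ex_intro _ u Cu).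
Qed.

Lemma support_fun_le C y r : C !=set0 -> (forall u, C u -> inner y u <= r) ->
  support_fun C y <= r.
Proof.
move=> [c0 Cc0] h; apply: ge_sup; first by exists (inner y c0), c0.
by move=> _ [u Cu <-]; exact: h.
Qed.

(** For the projection [c] of [v], the support function at [v - c] is at most [inner (v - c) c]; the
    hypothesis at [w = v - c] then forces [v = c]. *)
Lemma mem_of_support_fun C v : compact C -> convex_set C -> C !=set0 ->
  (forall w, inner w v <= support_fun C w) -> C v.
Proof.
move=> cC cvxC C0 h.
have [c Cc cmin] := projection v (compact_closed (@norm_hausdorff _ _) cC) cvxC C0.
suff -> : v = c by [].
apply/eqP; rewrite -subr_eq0 -normr_eq0 -sqrf_eq0 eq_le sqr_ge0 andbT.
rewrite -inner_norm innerBr subr_le0 (le_trans (h _))//.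
apply: support_fun_le => // z /cmin; by rewrite innerBr subr_le0.
Qed.

(** The residual [v - c] of the projection onto a cone is orthogonal to [c], because the multiples 2
    and 0 of [c] stay in the cone. Hence it lies in the polar, and tested against [v] it gives its
    own squared norm. *)
Lemma bipolar C v : pointed_closed_convex_cone C ->
  (forall u, polar C u -> inner u v <= 0) -> C v.
Proof.
move=> [clC cvxC coneC C0] h.
have Czero : C 0 by have : (C `&` [set - y | y in C]) 0; [rewrite C0|case].
have [c Cc cmin] := projection v clC cvxC (ex_intro _ 0 Czero).
have c0 : inner (v - c) c = 0.
  apply/eqP; rewrite eq_le; apply/andP; split.
    have := cmin (2 *: c) (coneC _ _ (ler0n _ 2) Cc).
    by rewrite scaler_nat mulr2n addrK.
  by have := cmin 0 Czero; rewrite sub0r innerNr oppr_le0.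
have : inner (v - c) v <= 0.
  by apply: h => z /cmin; rewrite innerBr c0 subr0.
rewrite -{2}[v](subrK c) innerDr c0 addr0 inner_norm => nv.
suff -> : v = c by [].
by apply/eqP; rewrite -subr_eq0 -normr_eq0 -sqrf_eq0 eq_le sqr_ge0 andbT.
Qed.

End euclidean_finite_dim.

(** * Calculus *)

Section operator_norm.
Context {R : realType} {X : euclidType R} {W : normedModType R}.
Implicit Types (f : X -> W) (v : X).

Lemma opnorm_has_ub f : linear f ->
  has_ubound [set `|f v| | v in closed_ball_ Num.norm 0 1].
Proof.
move=> /linear_bounded[c [c0 fc]]; exists c => _ [v /= v1 <-].
rewrite (le_trans (fc v))// ler_piMr//.
by rewrite /closed_ball_ /= sub0r normrN in v1.
Qed.

Lemma opnorm_ge0 f : linear f -> 0 <= opnorm f.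
Proof.
move=> flin; apply: (@le_trans _ _ `|f 0|) => //.
apply: (ub_le_sup (opnorm_has_ub flin)); exists 0 => //.
by rewrite /closed_ball_ /= subr0 normr0 ler01.
Qed.

Lemma le_opnorm f v : linear f -> `|f v| <= opnorm f * `|v|.
Proof.
move=> flin.
pose fM := GRing.isLinear.Build _ _ _ _ f flin.
pose fL : {linear X -> W} := HB.pack f fM.
have [->|v0] := eqVneq v 0.
  by rewrite -[f]/(fL : X -> W) linear0 !normr0 mulr0.
have nv : 0 < `|v| by rewrite normr_gt0.
rewrite -ler_pdivrMr//; apply: (ub_le_sup (opnorm_has_ub flin)).
exists (`|v|^-1 *: v).
  rewrite /closed_ball_ /= sub0r normrN normrZ normfV normr_id mulVf//.
  by rewrite gt_eqF.
by rewrite -[f]/(fL : X -> W) linearZ/= normrZ normfV normr_id mulrC.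
Qed.

Lemma opnorm_le f c : (forall v, `|v| <= 1 -> `|f v| <= c) -> opnorm f <= c.
Proof.
move=> fc; apply: ge_sup.
  by exists `|f 0|, 0 => //; rewrite /closed_ball_ /= subr0 normr0 ler01.
by move=> _ [v /= v1 <-]; apply: fc; rewrite /closed_ball_ /= sub0r normrN in v1.
Qed.

End operator_norm.

Section calculus.
Context {R : realType}.

Lemma grad_inner (V : euclidType R) (f : V -> R) x v : inner (grad f x) v = 'd (f : V -> R^o) x v.
Proof.
have [w wE] := riesz (l := 'd (f : V -> R^o) x) (fun a => linearP _ a).
rewrite /grad; case: xgetP => [z _ /= ->//|/(_ w)].
by move=> /(_ wE).
Qed.

Lemma is_derive_line (V W : normedModType R) (F : V -> W) (x d : V) (r : R) :
  differentiable F (x + r *: d) ->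
  is_derive r (1 : R) (fun a => F (x + a *: d)) ('d F (x + r *: d) d).
Proof.
move=> dF; have drv := diff_derivable (v := d) dF.
have E : (fun h : R => h^-1 *: (((fun a => F (x + a *: d)) \o shift r) (h *: (1 : R))
    - F (x + r *: d))) =
  (fun h => h^-1 *: ((F \o shift (x + r *: d)) (h *: d) - F (x + r *: d))).
  apply/funext => h /=; congr (_ *: (F _ - _)).
  by rewrite [_ *: 1]mulr1 scalerDl addrCA.
apply: DeriveDef.
  by rewrite /derivable E.
by rewrite /derive E -deriveE.
Qed.

(** [phi] minus the antiderivative of the affine bound has nonpositive slope, so the mean value
    theorem replaces integration. The later second-order bounds are this lemma along a segment. *)
Lemma scalar_mean_value_le (phi dphi : R -> R) (a C : R) :
  (forall r : R, is_derive r 1 phi (dphi r)) ->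
  (forall r, 0 <= r <= 1 -> dphi r <= a + C * r) ->
  phi 1 <= phi 0 + a + C / 2.
Proof.
move=> dE dle.
pose g r := phi r - (a * r + C / 2 * r ^+ 2).
have dg (r : R) : is_derive r 1 g (dphi r - (a + C * r)).
  have dphir := dE r; rewrite /g.
  apply: is_derive_eq.
  rewrite /GRing.scale/=; lra.
have cg : {within `[0, 1], continuous g}.
  apply: continuous_subspaceT => z.
  apply: differentiable_continuous; apply/derivable1_diffP.
  exact: ex_derive.
have [c c01 e] := MVT ltr01 (fun r _ => dg r) cg.
have c1 : 0 <= c <= 1 by rewrite !ltW ?(itvP c01).
have : g 1 - g 0 <= 0.
  by rewrite e subr0 mulr1 subr_le0; exact: dle.
rewrite /g; lra.
Qed.

Context {X Y : euclidType R}.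

Lemma adjoint_inner (A : X -> Y) u v : linear A ->
  inner (adjoint A u) v = inner u (A v).
Proof.
move=> Alin.
have [|w wE] := riesz (l := fun v => inner u (A v)).
  by move=> a b c; rewrite Alin innerDr innerZr.
rewrite /adjoint; case: xgetP => [z _ /= ->//|/(_ w)].
by move=> /(_ wE).
Qed.

Lemma adjointD (A : X -> Y) u v : linear A ->
  adjoint A (u + v) = adjoint A u + adjoint A v.
Proof. by move=> Al; apply: inner_eq => z; rewrite innerDl !adjoint_inner// innerDl. Qed.

Lemma adjointZ (A : X -> Y) a u : linear A ->
  adjoint A (a *: u) = a *: adjoint A u.
Proof. by move=> Al; apply: inner_eq => z; rewrite innerZl !adjoint_inner// innerZl. Qed.

Lemma norm_adjoint_le (A : X -> Y) u c : linear A -> 0 <= c ->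
  (forall v, `|A v| <= c * `|v|) -> `|adjoint A u| <= c * `|u|.
Proof.
move=> Al c0 Ac; apply: norm_le_inner => [|v]; first by rewrite mulr_ge0.
rewrite adjoint_inner// (le_trans (inner_le _ _))// [c * _]mulrC -mulrA.
by rewrite ler_wpM2l.
Qed.

Lemma inner_continuous (u : Y) : continuous (inner u : Y -> R^o).
Proof.
move=> x; apply/cvgrPdist_le => e e0.
have u1 : 0 < `|u| + 1 by rewrite ltr_wpDl.
near=> y; rewrite -innerBr (le_trans (norm_inner_le _ _))//.
rewrite (@le_trans _ _ ((`|u| + 1) * `|x - y|))//.
  by rewrite ler_wpM2r// lerDl.
rewrite mulrC -ler_pdivlMr//.
near: y; apply: cvgr_dist_le => //; by rewrite divr_gt0.
Unshelve. all: by end_near. Qed.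

Lemma differentiable_inner (u : Y) (F : X -> Y) x : differentiable F x ->
  differentiable (fun y => inner u (F y) : R^o) x /\
  forall v, 'd (fun y => inner u (F y) : R^o) x v = inner u ('d F x v).
Proof.
move=> dF.
have ilin : linear (inner u : Y -> R^o).
  by move=> a v w; rewrite innerDr innerZr.
pose iM := GRing.isLinear.Build _ _ _ _ (inner u : Y -> R^o) ilin.
pose iL : {linear Y -> R^o} := HB.pack (inner u : Y -> R^o) iM.
have di := linear_differentiable (f := iL) (F x) (@inner_continuous u).
split; first exact: (differentiable_comp dF di).
by move=> v; rewrite (diff_comp dF di) /= (diff_lin (f := iL))//; exact: inner_continuous.
Qed.

Lemma grad_comp (h : Y -> R) (G : X -> Y) x : differentiable G x ->
  differentiable (h : Y -> R^o) (G x) ->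
  grad (fun y => h (G y)) x = adjoint ('d G x) (grad h (G x)).
Proof.
move=> dG dh; apply: inner_eq => v; rewrite grad_inner adjoint_inner; last first.
  by move=> a; exact: linearP.
by rewrite grad_inner (diff_comp dG dh).
Qed.

Lemma smooth_diff_le (W : normedModType R) L (F : X -> W) x y v : smooth L F ->
  `|'d F x v - 'd F y v| <= L * `|x - y| * `|v|.
Proof.
move=> [dF FL].
have := @le_opnorm _ _ _ ('d F x \- 'd F y) v.
rewrite /= => /(_ _)/le_trans; apply; last by rewrite ler_wpM2r.
move=> a u w.
change ('d F x (a *: u + w) - 'd F y (a *: u + w) =
  a *: ('d F x u - 'd F y u) + ('d F x w - 'd F y w)).
have lP z : 'd F z (a *: u + w) = a *: 'd F z u + 'd F z w by exact: linearP.
by rewrite !lP scalerBr opprD addrACA.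
Qed.

Lemma smooth_descent L (f : X -> R) x d : smooth L (f : X -> R^o) ->
  f (x + d) <= f x + inner (grad f x) d + L / 2 * `|d| ^+ 2.
Proof.
move=> sf; have [df _] := sf; rewrite grad_inner.
have := @scalar_mean_value_le (fun r => f (x + r *: d))
  (fun r => 'd (f : X -> R^o) (x + r *: d) d) ('d (f : X -> R^o) x d)
  (L * `|d| ^+ 2).
rewrite scale1r scale0r addr0 mulrAC; apply.
  by move=> r; exact: (@is_derive_line X R^o f).
move=> r /andP[r0 _]; rewrite -lerBlDl.
apply: (le_trans (ler_norm _)).
apply: (le_trans (smooth_diff_le (x + r *: d) x d sf)).
by rewrite [x + _]addrC addrK normrZ ger0_norm//; lra.
Qed.

(** Pairing with a fixed [u] reduces a vector map to a scalar function; used with [- u], it also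
    bounds from below. *)
Lemma smooth_descent_inner L (F : X -> Y) x d u : smooth L F ->
  inner u (F (x + d)) <=
    inner u (F x) + inner u ('d F x d) + `|u| * L / 2 * `|d| ^+ 2.
Proof.
move=> sF; have [dF _] := sF.
have := @scalar_mean_value_le (fun r => inner u (F (x + r *: d)))
  (fun r => inner u ('d F (x + r *: d) d)) (inner u ('d F x d))
  (`|u| * L * `|d| ^+ 2).
rewrite scale1r scale0r addr0 [_ * _ / 2]mulrAC; apply.
  move=> r; have [du duE] := differentiable_inner u (dF (x + r *: d)).
  by rewrite -duE; exact: (@is_derive_line X R^o).
move=> r /andP[r0 _]; rewrite -lerBlDl -innerBr.
apply: (le_trans (inner_le _ _)).
have -> : `|u| * L * `|d| ^+ 2 * r = `|u| * (L * (r * `|d|) * `|d|) by ring.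
rewrite ler_wpM2l//.
apply: (le_trans (smooth_diff_le (x + r *: d) x d sF)).
by rewrite [x + _]addrC addrK normrZ ger0_norm.
Qed.

Lemma mean_value_norm_le (F : X -> Y) x d M : (forall x, differentiable F x) ->
  (forall r, 0 <= r <= 1 -> `|'d F (x + r *: d) d| <= M * `|d|) ->
  `|F (x + d) - F x| <= M * `|d|.
Proof.
(* Pairing with the increment [u] itself bounds its squared norm, and one factor of that norm
   cancels. *)
move=> dF FM; set u := F _ - F _.
have Md : 0 <= M * `|d|.
  by apply: le_trans (FM 0 _); rewrite // lexx ler01.
have := @scalar_mean_value_le (fun r => inner u (F (x + r *: d)))
  (fun r => inner u ('d F (x + r *: d) d)) (`|u| * (M * `|d|)) 0.
rewrite scale1r scale0r addr0 mul0r addr0 => h.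
have : inner u (F (x + d)) <= inner u (F x) + `|u| * (M * `|d|).
  apply: h => r.
    have [du duE] := differentiable_inner u (dF (x + r *: d)).
    by rewrite -duE; exact: (@is_derive_line X R^o).
  move=> r01; rewrite mul0r addr0 (le_trans (inner_le _ _))// ler_wpM2l//.
  exact: FM.
rewrite -lerBlDl -innerBr inner_norm expr2.
by have [->//|u0] := eqVneq `|u| 0; rewrite ler_pM2l// lt_neqAle eq_sym u0/=.
Qed.

(** Convexity bounds the difference quotients with step in [(0, 1]] by [h (y + v) - h y]; their
    limit at 0 from the right is the derivative. *)
Lemma convex_grad_le (h : X -> R) y v : convex_function [set: X] h ->
  differentiable (h : X -> R^o) y -> h y + inner (grad h y) v <= h (y + v).
Proof.
move=> cvxh dh; rewrite grad_inner -lerBrDl -deriveE//.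
have drv := diff_derivable (v := v) dh.
have := @cvg_dnbhs_at_right R _ _ 0 _ drv.
move=> drv'; rewrite /derive -(cvg_lim _ drv')//.
apply: limr_le; first by apply/cvg_ex; eexists; exact: drv'.
near=> r.
have r0 : 0 < r by near: r; exact: nbhs_right_gt.
have r1 : r <= 1 by near: r; exact: nbhs_right_ltW.
rewrite /= [_ *: _]mulrC ler_pdivrMr//.
have := convex_functionP (y + v) y cvxh (ltW r0) r1.
have -> : r *: (y + v) + (1 - r) *: y = r *: v + y.
  by rewrite scalerDr scalerBl scale1r [r *: y + _]addrC -addrA [r *: y + _]addrC subrK.
lra.
Unshelve. all: by end_near. Qed.

End calculus.

(** * Convex functions *)

Section convex_functions.
Context {R : realType} {V : euclidType R}.
Implicit Types (P : V -> R) (x y z v : V).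

(** Phrased for a sum rather than an average, so that a coordinate expansion can be split off term
    by term. *)
Lemma convex_midpoint P x y : convex_function [set: V] P ->
  P (x + y) <= 2^-1 * P (2 *: x) + 2^-1 * P (2 *: y).
Proof.
move=> cvxP.
have := convex_functionP (2 *: x) (2 *: y) cvxP (a := 2^-1).
have -> : 1 - 2^-1 = 2^-1 :> R by lra.
by rewrite !scalerA mulVf// !scale1r; apply; lra.
Qed.

Lemma convex_segment_le P v r a : convex_function [set: V] P -> `|a| <= r ->
  0 < r -> P (a *: v) <= Num.max (P (r *: v)) (P (- r *: v)).
Proof.
rewrite ler_norml => cvxP /andP[ra ar] r0.
pose b := (a + r) / (2 * r).
have b0 : 0 <= b by rewrite divr_ge0//; lra.
have b1 : b <= 1 by rewrite ler_pdivrMr; lra.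
have -> : a *: v = b *: (r *: v) + (1 - b) *: (- r *: v).
  rewrite !scalerA -scalerDl; congr (_ *: _); rewrite /b; field; lra.
apply: (le_trans (convex_functionP _ _ cvxP b0 b1)).
set m := Num.max _ _.
have h1 : b * P (r *: v) <= b * m by rewrite ler_wpM2l// le_max lexx.
have h2 : (1 - b) * P (- r *: v) <= (1 - b) * m.
  by rewrite ler_wpM2l ?subr_ge0// le_max lexx orbT.
lra.
Qed.

Lemma convex_bounded_above P r : convex_function [set: V] P ->
  exists c, forall x, `|x| <= r -> P x <= c.
Proof.
move=> cvxP; have [n [e [w ew]]] := coordinates (V := V).
(* Each split by [convex_midpoint] doubles the coefficients, so the radius [rho] must vary through
   the induction on the list of coordinates. *)
have cube (I : seq 'I_n) : forall rho, exists c, forall a : 'I_n -> R,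
    (forall i, `|a i| <= rho) -> P (\sum_(i <- I) a i *: e i) <= c.
  elim: I => [|i I IH] rho.
    by exists (P 0) => a _; rewrite big_nil.
  have [c hc] := IH (2 * rho).
  exists (2^-1 * Num.max (P ((`|2 * rho| + 1) *: e i)) (P (- (`|2 * rho| + 1) *: e i))
    + 2^-1 * c) => a ha.
  rewrite big_cons; apply: (le_trans (convex_midpoint _ _ cvxP)).
  apply: lerD; rewrite ler_wpM2l//.
    rewrite scalerA; have r0 : 0 < `|2 * rho| + 1 by rewrite ltr_wpDl.
    apply: convex_segment_le => //.
    rewrite normrM ger0_norm//.
    have := ha i; have := ler_norm (2 * rho); lra.
  rewrite scaler_sumr.
  under eq_bigr do rewrite scalerA.
  by apply: hc => k; rewrite normrM ger0_norm// ler_wpM2l.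
have [c hc] := cube (index_enum _) ((\sum_i `|w i|) * r).
exists c => x xr; rewrite [x]ew; apply: hc => i.
rewrite (le_trans (norm_inner_le _ _))// ler_pM// (bigD1 i)//= lerDl.
exact: sumr_ge0.
Qed.

(** Reflection through the origin: [2 * P 0 <= P x + P (- x)], and [P (- x)] is bounded above. *)
Lemma convex_bounded_below P r : convex_function [set: V] P ->
  exists c, forall x, `|x| <= r -> c <= P x.
Proof.
move=> cvxP; have [c hc] := convex_bounded_above (2 * r) cvxP.
exists (2 * P 0 - c) => x xr.
have := convex_midpoint (2^-1 *: x) (- 2^-1 *: x) cvxP.
rewrite -scalerDl subrr scale0r !scalerA mulrN mulfV// scale1r scaleN1r.
have : P (- x) <= c by apply: hc; rewrite normrN; have := normr_ge0 x; lra.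
lra.
Qed.

(** A unit step from [x] along [z] raises the affine minorant by the norm of [z], which is thus at
    most the gap between an upper bound of [P] on radius [r + 1] and a lower bound on radius [r]. *)
Lemma subdiff_bounded P r : convex_function [set: V] P ->
  exists c, forall x z, `|x| <= r -> subdiff P x z -> `|z| <= c.
Proof.
move=> cvxP; have [c hc] := convex_bounded_above (r + 1) cvxP.
have [b hb] := convex_bounded_below r cvxP.
exists (Num.max 0 (c - b)) => x z xr xz.
rewrite le_max normr_le0; case: eqVneq => //= z0.
have nz : 0 < `|z| by rewrite normr_gt0.
have := xz (x + `|z|^-1 *: z).
rewrite [x + _]addrC addrK innerZr inner_norm expr2 mulKf ?gt_eqF// => h.
have := hb x xr.
have : P (`|z|^-1 *: z + x) <= c.
  apply: hc; rewrite addrC (le_trans (ler_normD _ _))// lerD//.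
  by rewrite normrZ normfV normr_id mulVf// gt_eqF.
lra.
Qed.

(* Fermat's rule for the sum of a convex function and an exact quadratic. *)
Lemma subdiff_add_quadratic P (Q : V -> R) x a C : convex_function [set: V] P ->
  (forall v, Q (x + v) = Q x + inner a v + C * `|v| ^+ 2) ->
  subdiff (fun y => P y + Q y) x 0 -> subdiff P x (- a).
Proof.
move=> cvxP QE h y; set v := y - x.
have yE : y = x + v by rewrite /v addrC subrK.
rewrite innerNl -lerBrDl lerNl opprB; apply/ler_addgt0Pr => e e0.
(* Along [x + r *: v] the quadratic term, divided by [r], is at most [r * n]; the choice of [r]
   keeps this below [e]. *)
pose n := `|C| * `|v| ^+ 2 + 1.
have n0 : 0 < n by rewrite ltr_wpDl// mulr_ge0.
pose r := Num.min 1 (e / n).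
have r0 : 0 < r by rewrite lt_min ltr01 divr_gt0.
have r1 : r <= 1 by rewrite ge_min lexx.
have rn : r * n <= e by rewrite -ler_pdivlMr// ge_min lexx orbT.
have := h (x + r *: v); rewrite inner0l addr0 QE innerZr normrZ ger0_norm ?(ltW r0)//.
have := convex_functionP y x cvxP (ltW r0) r1.
have -> : r *: y + (1 - r) *: x = x + r *: v.
  rewrite yE scalerDr scalerBl scale1r [r *: x + _]addrC -addrA.
  by rewrite [r *: x + _]addrC subrK addrC.
move=> h1 h2.
have h3 : r * (P x - P y) <= r * (inner a v + C * (r * `|v| ^+ 2)).
  by rewrite exprMn in h2; lra.
rewrite ler_pM2l// in h3.
have h4 : C * (r * `|v| ^+ 2) <= r * n.
  rewrite mulrCA ler_wpM2l ?(ltW r0)// /n.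
  by have := ler_wpM2r (sqr_ge0 `|v|) (ler_norm C); lra.
lra.
Qed.

End convex_functions.

(** * Bounds over bounded sets *)

Section bounds.
Context {R : realType} {X Y : euclidType R}.

Lemma linear_diff (V : euclidType R) (W : normedModType R) (F : V -> W) x : linear ('d F x).
Proof. by move=> a u v; exact: linearP. Qed.

Lemma closed_ball0_convex (V : euclidType R) (M : R) : convex_set [set x : V | `|x| <= M].
Proof.
move=> x y l; rewrite !inE /= => xM yM.
have l0 : 0 <= l%:num by [].
have l1 : 0 <= 1 - l%:num by rewrite subr_ge0.
apply: (@le_trans _ _ `|l%:num *: x + (1 - l%:num) *: y|) => //.
apply: (le_trans (ler_normD _ _)); rewrite !normrZ !ger0_norm//.
have := ler_wpM2l l0 xM; have := ler_wpM2l l1 yM.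
lra.
Qed.

Lemma opnorm_diff_bounded (W : normedModType R) L (F : X -> W) (S : set X) M : smooth L F ->
  0 <= L -> (forall x, S x -> `|x| <= M) ->
  has_ubound [set opnorm ('d F x) | x in S].
Proof.
move=> sF L0 SM; exists (opnorm ('d F 0) + L * M) => _ [x Sx <-].
apply: opnorm_le => v v1.
rewrite -[X in `|X|](subrK ('d F 0 v)) addrC (le_trans (ler_normD _ _))//.
apply: lerD.
  rewrite (le_trans (le_opnorm _ (linear_diff F 0)))// ler_piMr//.
  exact/opnorm_ge0/linear_diff.
rewrite (le_trans (smooth_diff_le _ _ _ sF))// subr0 -mulrA ler_wpM2l//.
rewrite (@le_trans _ _ `|x|)// ?SM//.
by rewrite ler_piMr.
Qed.

Lemma norm_diff_le_sup (W : normedModType R) L (F : X -> W) (S : set X) M x v : smooth L F ->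
  0 <= L -> (forall x, S x -> `|x| <= M) -> S x ->
  `|'d F x v| <= sup [set opnorm ('d F x) | x in S] * `|v|.
Proof.
move=> sF L0 SM Sx; rewrite (le_trans (le_opnorm _ (linear_diff F x)))//.
rewrite ler_wpM2r// ub_le_sup//; last by exists x.
exact: (opnorm_diff_bounded sF L0 SM).
Qed.

(** An empty or unbounded set is covered as well, since [sup] then takes its default value 0; the
    signs of the constants thus precede their finiteness. *)
Lemma sup_ge0 (S : set R) : (forall x, S x -> 0 <= x) -> 0 <= sup S.
Proof.
move=> S0; have [hs|ns] := pselect (has_sup S); last by rewrite sup_out.
have [[x Sx] ub] := hs.
by rewrite (le_trans (S0 x Sx))// ub_le_sup.
Qed.

Lemma grad_lipschitz L (f : X -> R) x y : 0 <= L -> smooth L (f : X -> R^o) ->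
  `|grad f x - grad f y| <= L * `|x - y|.
Proof.
move=> L0 sf; apply: norm_le_inner => [|v]; first by rewrite mulr_ge0.
rewrite innerBl !grad_inner (le_trans (ler_norm _))//.
exact: smooth_diff_le sf.
Qed.

Lemma smooth_norm_bounded L (F : X -> Y) M : smooth L F -> 0 <= L ->
  exists c, forall x, `|x| <= M -> `|F x| <= c.
Proof.
move=> sF L0.
pose S := [set x : X | `|x| <= M].
exists (`|F 0| + sup [set opnorm ('d F x) | x in S] * M) => x xM.
have -> : F x = F 0 + (F (0 + x) - F 0) by rewrite add0r addrC subrK.
rewrite (le_trans (ler_normD _ _))// lerD2l.
rewrite (@le_trans _ _ (sup [set opnorm ('d F x) | x in S] * `|x|))//.
  apply: mean_value_norm_le; first by case: sF.
  move=> r /andP[r0 r1]; apply: (norm_diff_le_sup _ sF L0 (M := M)) => //.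
  rewrite /S/= add0r normrZ ger0_norm// (le_trans _ xM)//.
  by rewrite ler_piMl.
rewrite ler_wpM2l// sup_ge0// => _ [z _ <-]; exact/opnorm_ge0/linear_diff.
Qed.

(** Take the least power of 2 above [c]: unless it is 1, half of it is below [c]. This is the source
    of the maxima with 2 in [M_L]. *)
Lemma pow2_bracket (c : R) : exists n, c <= 2 ^+ n /\ 2 ^+ n <= Num.max 2 (2 * c).
Proof.
have ex : exists n, c <= 2 ^+ n.
  exists (Num.truncn c).+1; apply: (le_trans (ltW (truncnS_gt c))).
  by rewrite -natrX ler_nat ltnW// ltn_expl.
case: (ex_minnP ex) => -[|n] cn nmin.
  by exists 0%N; split => //; rewrite expr0 le_max ler1n.
exists n.+1; split => //; rewrite le_max exprS; apply/orP; right.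
rewrite ler_wpM2l// leNgt; apply/negP => /ltW /nmin.
by rewrite ltnn.
Qed.

End bounds.

(** * The smoothed constraint *)

Section smoothing_family.
Context {R : realType} {X Y : euclidType R}.
Context (p : problem X Y) (s : smoothing Y).
Hypotheses (hA : assumptionA p) (hB : assumptionB p s).

Let cB := B_base_compact hB.

Lemma base_convex : convex_set (base s).
Proof. by have [] := B_base hB. Qed.

Lemma base_polar u : base s u -> polar (Kcone p) u.
Proof.
move=> Bu; have [_ _ ->] := B_base hB.
by exists 1 => /=; [exact: ler01|exists u; rewrite ?scale1r].
Qed.

Lemma polar_base u : polar (Kcone p) u -> exists r v, [/\ 0 <= r, base s v & u = r *: v].
Proof. by have [_ _ ->] := B_base hB => -[r /= r0 [v Bv <-]]; exists r, v. Qed.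

Lemma base_nonempty : base s !=set0.
Proof.
have : polar (Kcone p) 0 by move=> w _; rewrite inner0l.
by move=> /polar_base[r [v [_ Bv _]]]; exists v.
Qed.

Lemma base_norm_le u : base s u -> `|u| <= M_B s.
Proof.
move=> Bu; have [M [M0 BM]] := bounded_set_norm_le (compact_bounded cB).
apply: ub_le_sup; last by exists u.
by exists M => _ [v Bv <-]; exact: BM.
Qed.

Lemma M_B_ge0 : 0 <= M_B s.
Proof. by apply: sup_ge0 => _ [u _ <-]. Qed.

(* [hfam s m] exceeds the sublinear [support_fun (base s)] by a bounded amount only,
   so its slope along a ray in direction [w] is at most the support function at [w]. *)
Lemma inner_grad_hfam_le m y w : 0 < m ->
  inner (grad (hfam s m) y) w <= support_fun (base s) w.
Proof.
move=> m0; set v := grad _ _; rewrite leNgt; apply/negP => vw.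
pose g := inner v w - support_fun (base s) w.
have g0 : 0 < g by rewrite subr_gt0.
pose n := support_fun (base s) y + alpha3 s * m - hfam s m y.
have /andP[_ hy] := B_approx hB y m0.
have n0 : 0 <= n by rewrite subr_ge0.
pose r := (n + 1) / g.
have r0 : 0 < r by rewrite divr_gt0// ltr_wpDl.
have := convex_grad_le (r *: w) (B_convex hB m0) (B_diff hB y m0).
have /andP[_ +] := B_approx hB (y + r *: w) m0.
have : support_fun (base s) (y + r *: w) <=
    support_fun (base s) y + r * support_fun (base s) w.
  apply: support_fun_le; first exact: base_nonempty.
  move=> u Bu; rewrite innerDl innerZl lerD ?support_fun_ge//.
  by rewrite ler_wpM2l ?(ltW r0)// support_fun_ge.
rewrite innerZr => h1 h2 h3.
have : r * g <= n by rewrite /g mulrBr /n; rewrite -/v in h3; lra.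
rewrite /r divfK ?gt_eqF//; lra.
Qed.

Lemma grad_hfam_base m y : 0 < m -> base s (grad (hfam s m) y).
Proof.
move=> m0; apply: (mem_of_support_fun cB base_convex base_nonempty) => w.
by rewrite innerC; exact: inner_grad_hfam_le.
Qed.

(* The gradient inequality evaluated at the origin, where the support function is 0. *)
Lemma hfam_le_inner m y : 0 < m ->
  hfam s m y <= inner (grad (hfam s m) y) y + alpha3 s * m.
Proof.
move=> m0; have := convex_grad_le (- y) (B_convex hB m0) (B_diff hB y m0).
rewrite subrr innerNr.
have /andP[_] := B_approx hB 0 m0.
have : support_fun (base s) 0 <= 0.
  by apply: support_fun_le => [|u _]; rewrite ?inner0l//; exact: base_nonempty.
lra.
Qed.

(** [g_mu] dominates the support function of the base, and the base generates the polar cone, so the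
    claim reduces to bipolarity. *)
Lemma g_smooth_feasible m x : 0 < m -> g_smooth p s m x <= 0 -> Kcone p (cstr p x).
Proof.
move=> m0 gx; apply: (bipolar (A_cone hA)) => u /polar_base[r [v [r0 Bv ->]]].
rewrite innerZl mulr_ge0_le0// innerC (le_trans (support_fun_ge _ cB Bv))//.
have /andP[h _] := B_approx hB (cstr p x) m0.
exact: le_trans gx.
Qed.

Lemma grad_g_smooth m x : 0 < m ->
  grad (g_smooth p s m) x = adjoint ('d (cstr p) x) (grad (hfam s m) (cstr p x)).
Proof.
move=> m0; apply: grad_comp; first by case: (A_cstr_smooth hA).
exact: (B_diff hB _ m0).
Qed.

Lemma inner_grad_g_smooth m x v : 0 < m -> inner (grad (g_smooth p s m) x) v =
  inner (grad (hfam s m) (cstr p x)) ('d (cstr p) x v).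
Proof. by move=> m0; rewrite grad_g_smooth// adjoint_inner//; exact: linear_diff. Qed.

(** Convexity of [hfam s m] disposes of its curvature and leaves only that of the constraint map.
    The constant is thus free of [1 / m], as [M2_bar] requires. *)
Lemma g_smooth_ge m x d : 0 < m ->
  g_smooth p s m x + inner (grad (g_smooth p s m) x) d
    - M_B s * LG p / 2 * `|d| ^+ 2 <= g_smooth p s m (x + d).
Proof.
move=> m0; rewrite inner_grad_g_smooth// /g_smooth.
set u := grad _ _.
have := convex_grad_le (cstr p (x + d) - cstr p x) (B_convex hB m0)
  (B_diff hB (cstr p x) m0).
rewrite [_ + (_ - _)]addrC subrK -/u innerBr.
have := smooth_descent_inner x d (- u) (A_cstr_smooth hA).
rewrite !innerNl normrN.
have : `|u| * LG p / 2 * `|d| ^+ 2 <= M_B s * LG p / 2 * `|d| ^+ 2.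
  rewrite ler_wpM2r// ler_wpM2r// ler_wpM2r ?(A_LG_ge0 hA)//.
  exact/base_norm_le/grad_hfam_base.
lra.
Qed.

Lemma grad_hfam_lipschitz m y z : 0 < m ->
  `|grad (hfam s m) y - grad (hfam s m) z| <= (alpha1 s + alpha2 s / m) * `|y - z|.
Proof. by move=> m0; have /(_ (y, z)) := B_lip hB m0; apply. Qed.

Lemma smoothing_lip_ge0 m : 0 < m -> 0 <= alpha1 s + alpha2 s / m.
Proof.
move=> m0; rewrite addr_ge0 ?(B_alpha1 hB)// divr_ge0// ltW//.
exact: B_alpha2 hB.
Qed.

Lemma hfam_le m y z : 0 < m -> hfam s m (y + z) <=
  hfam s m y + inner (grad (hfam s m) y) z + (alpha1 s + alpha2 s / m) / 2 * `|z| ^+ 2.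
Proof.
move=> m0.
have := @scalar_mean_value_le _ (fun r => hfam s m (y + r *: z))
  (fun r => inner (grad (hfam s m) (y + r *: z)) z)
  (inner (grad (hfam s m) y) z) ((alpha1 s + alpha2 s / m) * `|z| ^+ 2).
rewrite scale1r scale0r addr0 [_ * _ / 2]mulrAC; apply.
  move=> r; rewrite grad_inner.
  by apply: (@is_derive_line R Y R^o); exact: (B_diff hB _ m0).
move=> r /andP[r0 _]; rewrite -lerBlDl -innerBl (le_trans (inner_le _ _))//.
have := ler_wpM2r (normr_ge0 z) (grad_hfam_lipschitz (y + r *: z) y m0).
rewrite [y + _]addrC addrK normrZ ger0_norm// => /le_trans; apply.
by lra.
Qed.

(** Two curvatures add up: that of the constraint map, weighted by the gradient of [hfam s m], and
    that of [hfam s m], weighted by the squared increment of the map. The derivative is bounded only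
    along the segment because [M_G_hat] controls just the hull of [Omega0_hat]. *)
Lemma g_smooth_le m x d M : 0 < m ->
  (forall r, 0 <= r <= 1 -> `|'d (cstr p) (x + r *: d) d| <= M * `|d|) ->
  g_smooth p s m (x + d) <= g_smooth p s m x + inner (grad (g_smooth p s m) x) d
    + (M_B s * LG p + (alpha1 s + alpha2 s / m) * M ^+ 2) / 2 * `|d| ^+ 2.
Proof.
move=> m0 dM; rewrite inner_grad_g_smooth// /g_smooth.
set u := grad _ _; pose z := cstr p (x + d) - cstr p x.
have [dG _] := A_cstr_smooth hA.
have zM : `|z| <= M * `|d| by exact: mean_value_norm_le.
have := hfam_le (cstr p x) z m0.
rewrite [_ + z]addrC subrK -/u innerBr.
have := smooth_descent_inner x d u (A_cstr_smooth hA).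
have : `|u| * LG p / 2 * `|d| ^+ 2 <= M_B s * LG p / 2 * `|d| ^+ 2.
  rewrite ler_wpM2r// ler_wpM2r// ler_wpM2r ?(A_LG_ge0 hA)//.
  exact/base_norm_le/grad_hfam_base.
have : (alpha1 s + alpha2 s / m) / 2 * `|z| ^+ 2 <=
       (alpha1 s + alpha2 s / m) / 2 * (M * `|d|) ^+ 2.
  rewrite ler_wpM2l ?divr_ge0 ?smoothing_lip_ge0//.
  by rewrite ler_sqr ?nnegrE// (le_trans _ zM).
rewrite exprMn; lra.
Qed.

Lemma grad_g_smooth_le m x c : 0 < m -> 0 <= c ->
  (forall v, `|'d (cstr p) x v| <= c * `|v|) ->
  `|grad (g_smooth p s m) x| <= c * M_B s.
Proof.
move=> m0 c0 dc; rewrite grad_g_smooth//.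
rewrite (le_trans (norm_adjoint_le _ (linear_diff _ _) c0 dc))// ler_wpM2l//.
exact/base_norm_le/grad_hfam_base.
Qed.

Lemma grad_g_smooth_lipschitz m x y c M : 0 < m -> 0 <= c ->
  (forall v, `|'d (cstr p) x v| <= c * `|v|) ->
  `|cstr p x - cstr p y| <= M * `|x - y| ->
  `|grad (g_smooth p s m) x - grad (g_smooth p s m) y| <=
  (M_B s * LG p + (alpha1 s + alpha2 s / m) * (c * M)) * `|x - y|.
Proof.
move=> m0 c0 dc GM; rewrite !grad_g_smooth//.
set u := grad _ _; set v := grad _ _.
have lx := linear_diff (cstr p) x; have ly := linear_diff (cstr p) y.
have -> : adjoint ('d (cstr p) x) u - adjoint ('d (cstr p) y) v =
  adjoint ('d (cstr p) x) (u - v) +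
  (adjoint ('d (cstr p) x) v - adjoint ('d (cstr p) y) v).
  by rewrite addrA -adjointD// subrK.
apply: (le_trans (ler_normD _ _)); rewrite mulrDl addrC lerD//.
  apply: norm_le_inner => [|z].
    by rewrite mulr_ge0// mulr_ge0 ?M_B_ge0// (A_LG_ge0 hA).
  rewrite innerBl !adjoint_inner// -innerBr (le_trans (inner_le _ _))//.
  rewrite -!mulrA ler_pM//; first exact/base_norm_le/grad_hfam_base.
  rewrite mulrA; exact: smooth_diff_le (A_cstr_smooth hA).
apply: (le_trans (norm_adjoint_le _ lx c0 dc)).
have uv : `|u - v| <= (alpha1 s + alpha2 s / m) * (M * `|x - y|).
  rewrite (le_trans (grad_hfam_lipschitz _ _ m0))// ler_wpM2l//.
  exact: smoothing_lip_ge0.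
by have := ler_wpM2l c0 uv; lra.
Qed.

End smoothing_family.

(** * Exact expansion of the model Lagrangian *)

Section quadratic_model.
Context {R : realType} {V : euclidType R}.
Implicit Types (b w d v : V) (L l c g : R).

Lemma inner_model_grad b w d v L l c :
  inner (b + L *: d + l *: (w + c *: d)) v =
  inner b v + L * inner d v + l * (inner w v + c * inner d v).
Proof. by rewrite !(innerDl, innerZl). Qed.

(** The multiplier-weighted smooth part of a subproblem is itself quadratic, so its expansion at [d]
    has no remainder; this is the form that [subdiff_add_quadratic] takes. *)
Lemma quadratic_model_add b w d v L l c g :
  inner b (d + v) + L / 2 * `|d + v| ^+ 2
    + l * (g + inner w (d + v) + c / 2 * `|d + v| ^+ 2) =
  inner b d + L / 2 * `|d| ^+ 2 + l * (g + inner w d + c / 2 * `|d| ^+ 2)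
    + inner (b + L *: d + l *: (w + c *: d)) v + (L / 2 + l * (c / 2)) * `|v| ^+ 2.
Proof. rewrite inner_model_grad !innerDr normD_sqr; lra. Qed.

End quadratic_model.

(** * The subproblems of the algorithm *)

Section run.
Context {R : realType} {X Y : euclidType R}.
Context (p : problem X Y) (s : smoothing Y) (q : parameters R) (t : history X).
Hypotheses (hA : assumptionA p) (hB : assumptionB p s) (hrun : sMBA p s q t).

Let tau1_gt0 := run_tau1 hrun.
Let tau2_gt0 := run_tau2 hrun.
Let Lc_gt0 := run_Lcheck hrun.
Let LG_ge0 := A_LG_ge0 hA.

Lemma mu_gt0 k : 0 < mu t k.
Proof. by case: k => [|k]; [exact: run_mu0 hrun|have /andP[] := run_mu hrun k]. Qed.

Lemma mu_le k l : (k <= l)%N -> mu t l <= mu t k.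
Proof.
move=> /subnK <-; elim: (l - k)%N => [//|n IH]; rewrite addSn (le_trans _ IH)//.
by have /andP[_ /ltW] := run_mu hrun (n + k).
Qed.

Lemma Omega0_norm_bounded : exists M, 0 <= M /\ forall x, Omega0 p x -> `|x| <= M.
Proof. exact/bounded_set_norm_le/(A_bounded hA). Qed.

Lemma trial_mult_ge0 k i j : reached p s q t k i j -> 0 <= trial_mult t k i j.
Proof. by move=> /(run_trial_mult hrun)[]. Qed.

Lemma mult_ge0 k : 0 <= mult t k.+1.
Proof. by rewrite (run_mult hrun); apply: trial_mult_ge0; exact: run_reached hrun k. Qed.

Lemma psi_iterateS k : psi p (iterate t k.+1) <= psi p (iterate t k)
  - (tau1 q * mu t k + tau2 q * mult t k.+1) / (2 * mu t k)
    * `|iterate t k.+1 - iterate t k| ^+ 2.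
Proof. by rewrite (run_mult hrun) (run_iter hrun); have [] := run_accepted hrun k. Qed.

Lemma decrease_ge0 k : 0 <= (tau1 q * mu t k + tau2 q * mult t k.+1) / (2 * mu t k)
    * `|iterate t k.+1 - iterate t k| ^+ 2.
Proof.
have m0 := mu_gt0 k; have l0 := mult_ge0 k.
rewrite mulr_ge0// divr_ge0//; last by rewrite mulr_ge0// ltW.
by rewrite addr_ge0// mulr_ge0// ltW.
Qed.

Lemma g_smooth_iterateS k : g_smooth p s (mu t k) (iterate t k.+1) <= 0.
Proof. by rewrite (run_iter hrun); have [] := run_accepted hrun k. Qed.

(** Acceptance gives [g_mu <= 0] for the old parameter; lowering the parameter turns this into a
    strict margin, which [c_0] later measures relative to [mu]. *)
Lemma g_smooth_iterate_lt k : g_smooth p s (mu t k.+1) (iterate t k.+1) <=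
  - alpha4 s * (mu t k - mu t k.+1).
Proof.
have /andP[m0 m1] := run_mu hrun k.
have := B_decr hB (cstr p (iterate t k.+1)) m0 m1.
have := g_smooth_iterateS k; rewrite /g_smooth; lra.
Qed.

Lemma g_smooth_iterate k : g_smooth p s (mu t k) (iterate t k) <= 0.
Proof.
case: k => [|k]; first by rewrite (run_start hrun) ltW// (run_g0 hrun).
apply: (le_trans (g_smooth_iterate_lt k)).
have /andP[m0 m1] := run_mu hrun k.
by rewrite mulNr oppr_le0 mulr_ge0 ?subr_ge0 ?ltW// (B_alpha4 hB).
Qed.

Lemma iterate_Omega0 k : Omega0 p (iterate t k).
Proof.
split; last exact: (g_smooth_feasible hA hB (mu_gt0 k) (g_smooth_iterate k)).
elim: k => [|k IH]; first by rewrite (run_start hrun).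
apply: le_trans IH; apply: (le_trans (psi_iterateS k)).
by rewrite gerBl decrease_ge0.
Qed.

Lemma M_G_ge0 : 0 <= M_G p.
Proof. by apply: sup_ge0 => _ [x _ <-]; exact/opnorm_ge0/linear_diff. Qed.

Lemma diff_cstr_le x v : Omega0 p x -> `|'d (cstr p) x v| <= M_G p * `|v|.
Proof.
move=> xO; have [M [_ OM]] := Omega0_norm_bounded.
exact: (norm_diff_le_sup _ (A_cstr_smooth hA) LG_ge0 OM).
Qed.

Lemma M_R_ge0 : 0 <= M_R p s q t.
Proof.
rewrite addr_ge0 ?sqrtr_ge0//.
by rewrite !mulr_ge0 ?M_G_ge0 ?M_B_ge0 ?invr_ge0 ?ltW// mu_gt0.
Qed.

Lemma g_star_le x : Omega0 p x -> g_star p s <= g_base p s x.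
Proof.
move=> xO; have [M [M0 OM]] := Omega0_norm_bounded.
have [c Gc] := smooth_norm_bounded M (A_cstr_smooth hA) LG_ge0.
apply: ge_inf; last by exists x.
have [u Bu] := base_nonempty hB.
exists (- (c * `|u|)) => _ [y yO <-].
apply: le_trans (support_fun_ge _ (B_base_compact hB) Bu).
apply: (le_trans _ (inner_ge _ _)); rewrite lerN2 ler_wpM2r//.
exact/Gc/OM.
Qed.

Lemma Omega0_hat_bounded : exists M, 0 <= M /\ forall x, Omega0_hat p s q t x -> `|x| <= M.
Proof.
have [M [M0 OM]] := Omega0_norm_bounded.
exists (M + M_R p s q t); split; first by rewrite addr_ge0// M_R_ge0.
move=> _ [x xO [y yB <-]]; rewrite (le_trans (ler_normD _ _))// lerD ?OM//.
by move: yB; rewrite /closed_ball_ /= sub0r normrN.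
Qed.

Lemma sub_Omega0_hat x y : Omega0 p x -> `|y - x| <= M_R p s q t ->
  Omega0_hat p s q t y.
Proof.
move=> xO yx; exists x => //; exists (y - x); last by rewrite addrC subrK.
by rewrite /closed_ball_ /= sub0r normrN.
Qed.

Lemma Omega0_sub_hat x : Omega0 p x -> Omega0_hat p s q t x.
Proof. by move=> xO; apply: (sub_Omega0_hat xO); rewrite subrr normr0 M_R_ge0. Qed.

Lemma M_G_hat_ge0 : 0 <= M_G_hat p s q t.
Proof. by apply: sup_ge0 => _ [x _ <-]; exact/opnorm_ge0/linear_diff. Qed.

Lemma diff_cstr_segment_le x d v r : Omega0_hat p s q t x ->
  Omega0_hat p s q t (x + d) -> 0 <= r <= 1 ->
  `|'d (cstr p) (x + r *: d) v| <= M_G_hat p s q t * `|v|.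
Proof.
move=> xO dO /andP[r0 r1]; have [M [_ OM]] := Omega0_hat_bounded.
apply: (norm_diff_le_sup _ (A_cstr_smooth hA) LG_ge0 (M := M)).
  by move=> y /(_ [set x : X | `|x| <= M]); apply; split => //; exact: closed_ball0_convex.
move=> C [cvxC hC].
have -> : x + r *: d = r *: (x + d) + (1 - r) *: x.
  rewrite scalerDr scalerBl scale1r [r *: x + _]addrC -addrA.
  by rewrite [r *: x + _]addrC subrK addrC.
by apply: convex_setP => //; exact: hC.
Qed.

Lemma L_muE m : M_B s * LG p + (alpha1 s + alpha2 s / m) * M_G_hat p s q t ^+ 2
  = L_mu p s q t m.
Proof. rewrite /L_mu; ring. Qed.

(** Multiplication by the parameter leaves an affine function of it with nonnegative slope. *)
Lemma mul_L_mu_le m n : 0 < m -> m <= n -> m * L_mu p s q t m <= n * L_mu p s q t n.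
Proof.
move=> m0 mn; have n0 := lt_le_trans m0 mn.
have LE r : 0 < r -> r * L_mu p s q t r =
    r * (M_B s * LG p + alpha1 s * M_G_hat p s q t ^+ 2)
    + alpha2 s * M_G_hat p s q t ^+ 2.
  by move=> r0; rewrite /L_mu mulrDr [r * (_ / _)]mulrC divfK// gt_eqF.
rewrite !LE// lerD2r ler_wpM2r// addr_ge0// mulr_ge0 ?M_B_ge0 ?sqr_ge0//.
exact: (B_alpha1 hB).
Qed.

(** * One test of the backtracking *)

Section trial.
Variables k i j : nat.
Hypothesis hr : reached p s q t k i j.

Let x := iterate t k.
Let z := trial t k i j.
Let d := z - x.
Let m := mu t k.
Let lam := trial_mult t k i j.
Let w := grad (g_smooth p s m) x.
Let LF := 2 ^+ i * Lf0 t k.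
Let Lg := 2 ^+ j * Lg0 t k.

Let m_gt0 : 0 < m := mu_gt0 k.

Lemma Lcheck_le_LF : Lcheck q <= LF.
Proof.
have /andP[h _] := run_Lf0 hrun k; rewrite (le_trans h)// ler_peMl ?exprn_ege1 ?ler1n//.
by rewrite (le_trans _ h)// ltW.
Qed.

Lemma Lcheck_le_Lg : Lcheck q <= Lg.
Proof.
have /andP[h _] := run_Lg0 hrun k; rewrite (le_trans h)// ler_peMl ?exprn_ege1 ?ler1n//.
by rewrite (le_trans _ h)// ltW.
Qed.

Let Lg_gt0 : 0 < Lg := lt_le_trans Lc_gt0 Lcheck_le_Lg.

Lemma g_model_trial_le0 :
  g_smooth p s m x + inner w d + Lg / (2 * m) * `|d| ^+ 2 <= 0.
Proof. by have [[]] := run_trial hrun hr. Qed.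

Lemma trial_complementarity :
  lam * (g_smooth p s m x + inner w d + Lg / (2 * m) * `|d| ^+ 2) = 0.
Proof. by have [] := run_trial_mult hrun hr. Qed.

Lemma trial_stationarity : subdiff (P1 p) z
  (- (grad (obj p) x - xi t k + LF *: d + lam *: (w + (Lg / m) *: d))).
Proof.
have [_ _ h] := run_trial_mult hrun hr.
pose Q y := inner (grad (obj p) x - xi t k) (y - x) + LF / 2 * `|y - x| ^+ 2
  + lam * g_model p s t k j y.
have cE : Lg / (2 * m) = Lg / m / 2 by rewrite invfM mulrCA mulrC.
apply: (@subdiff_add_quadratic _ _ _ Q _ _ (LF / 2 + lam * (Lg / m / 2))).
- exact: A_P1_convex hA.
- move=> v; rewrite /Q /g_model -/x -/m -/w -/Lg cE.
  by rewrite [z + v - x]addrAC -/d quadratic_model_add.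
- by move=> y; have := h y; rewrite /Q /psi_model !addrA; exact: id.
Qed.

(** The subgradient of [P1] at [z] is tested at [x]. Complementarity eliminates [lam * inner w d],
    leaving half of the constraint curvature and a nonnegative term that is dropped. *)
Lemma trial_model_descent :
  P1 p z + inner (grad (obj p) x - xi t k) d
    + (LF + lam * (Lg / (2 * m))) * `|d| ^+ 2 <= P1 p x.
Proof.
have := trial_stationarity x; have := trial_complementarity.
have -> : x - z = - d by rewrite /d opprB.
rewrite innerNl innerNr opprK.
rewrite inner_model_grad inner_norm.
have -> : Lg / (2 * m) = Lg / m / 2 by rewrite invfM mulrCA mulrC.
have : lam * g_smooth p s m x <= 0.
  by rewrite mulr_ge0_le0 ?trial_mult_ge0// g_smooth_iterate.
lra.
Qed.

Lemma trial_psi_descent : psi p z <= psi p x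
  - (LF - Lf p / 2 + lam * (Lg / (2 * m))) * `|d| ^+ 2.
Proof.
have := trial_model_descent.
have := smooth_descent x d (A_obj_smooth hA).
have := run_xi hrun k z.
have -> : x + d = z by rewrite /d addrC subrK.
rewrite -/x -/d /psi innerBl; lra.
Qed.

(** [M_R] is the larger root of the quadratic inequality [h5], which the model constraint implies
    whether or not the trial point is accepted. *)
Lemma trial_dist_le : `|d| <= M_R p s q t.
Proof.
have xO := iterate_Omega0 k.
have h1 := g_model_trial_le0.
have h2 : g_star p s <= g_smooth p s m x.
  rewrite (le_trans (g_star_le xO))//.
  by have /andP[] := B_approx hB (cstr p x) m_gt0.
have h3 : - (M_G p * M_B s * `|d|) <= inner w d.
  rewrite (le_trans _ (inner_ge _ _))// lerN2 ler_wpM2r//.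
  apply: grad_g_smooth_le => //; first exact: M_G_ge0.
  by move=> v; exact: diff_cstr_le.
have cm_gt0 : 0 < Lg / (2 * m) by rewrite divr_gt0// mulr_gt0.
have h4 : Lg / (2 * m) * `|d| ^+ 2 <= M_G p * M_B s * `|d| - g_star p s by lra.
(* This sign allows [m / Lg] to be raised to the uniform [c] below. *)
have rhs0 : 0 <= M_G p * M_B s * `|d| - g_star p s.
  by apply: le_trans h4; rewrite mulr_ge0 ?sqr_ge0// (ltW cm_gt0).
pose c := mu t 0 * (Lcheck q)^-1.
have c0 : 0 < c by rewrite mulr_gt0 ?invr_gt0// mu_gt0.
have h5 : `|d| ^+ 2 <= 2 * c * (M_G p * M_B s * `|d| - g_star p s).
  have : `|d| ^+ 2 <= 2 * (m / Lg) * (M_G p * M_B s * `|d| - g_star p s).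
    have -> : 2 * (m / Lg) = (Lg / (2 * m))^-1.
      by rewrite invf_div mulrA.
    by rewrite ler_pdivlMl.
  move=> /le_trans; apply; rewrite ler_wpM2r// ler_wpM2l//.
  apply: ler_pM; [exact: ltW|by rewrite invr_ge0 ltW|exact: mu_le|].
  by rewrite lef_pV2 ?posrE// Lcheck_le_Lg.
rewrite /M_R -lerBlDr.
have -> : mu t 0 ^+ 2 * (Lcheck q) ^- 2 * M_G p ^+ 2 * M_B s ^+ 2 -
   2 * mu t 0 * (Lcheck q)^-1 * g_star p s =
   c ^+ 2 * M_G p ^+ 2 * M_B s ^+ 2 - 2 * c * g_star p s.
  by rewrite /c exprMn exprVn; ring.
rewrite (le_trans (ler_norm _))// -sqrtr_sqr ler_wsqrtr//.
by rewrite -/c; lra.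
Qed.

Let x_hat := Omega0_sub_hat (iterate_Omega0 k).
Let z_hat : Omega0_hat p s q t z := sub_Omega0_hat (iterate_Omega0 k) trial_dist_le.

Lemma g_smooth_trial_le : g_smooth p s m z <=
  g_smooth p s m x + inner w d + L_mu p s q t m / 2 * `|d| ^+ 2.
Proof.
have zE : x + d = z by rewrite /d addrC subrK.
rewrite -{1}zE -L_muE; apply: g_smooth_le => // r r01.
by apply: diff_cstr_segment_le => //; rewrite zE.
Qed.

Lemma trial_feasible : mu t 0 * L_mu p s q t (mu t 0) <= Lg -> g_smooth p s m z <= 0.
Proof.
move=> h; apply: (le_trans g_smooth_trial_le); apply: le_trans g_model_trial_le0.
rewrite lerD2l ler_wpM2r ?sqr_ge0// invfM [2^-1 * _]mulrC mulrA ler_wpM2r ?invr_ge0//.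
rewrite ler_pdivlMr// mulrC (le_trans _ h)// mul_L_mu_le//.
exact: mu_le.
Qed.

Lemma trial_accepted : Lf p + tau1 q <= LF ->
  Num.max (tau2 q) (mu t 0 * L_mu p s q t (mu t 0)) <= Lg -> accepted p s q t k i j.
Proof.
rewrite ge_max => hF /andP[h2 hg]; split; first exact: trial_feasible.
apply: (le_trans trial_psi_descent); rewrite -/x -/z -/d -/m -/lam.
rewrite lerD2l lerN2 ler_wpM2r ?sqr_ge0//.
(* The required decrease splits into a part paid by [LF] and a part paid by [Lg], hence the two
   separate thresholds. *)
have -> : (tau1 q * m + tau2 q * lam) / (2 * m) = tau1 q / 2 + lam * (tau2 q / (2 * m)).
  by field; rewrite gt_eqF.
apply: lerD; first by have := A_Lf_gt0 hA; have := tau1_gt0; lra.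
by rewrite ler_wpM2l ?trial_mult_ge0// ler_wpM2r// invr_ge0 mulr_ge0// ltW.
Qed.

End trial.
End run.

(** * Bounds on the backtracking and on the problem data *)

Section estimates.
Context {R : realType} {X Y : euclidType R}.
Context (p : problem X Y) (s : smoothing Y) (q : parameters R) (t : history X).
Hypotheses (hA : assumptionA p) (hB : assumptionB p s) (hrun : sMBA p s q t).

Let tau1_gt0 := run_tau1 hrun.
Let Lc_gt0 := run_Lcheck hrun.

(* Past [b] every test is feasible, so each further test raises [i]; past [a] as well
   the test is accepted. *)
Lemma reached_bound a b k i j :
  Lf p + tau1 q <= Lcheck q * 2 ^+ a ->
  Num.max (tau2 q) (mu t 0 * L_mu p s q t (mu t 0)) <= Lcheck q * 2 ^+ b ->
  reached p s q t k i j -> [/\ (i <= j)%N, (j <= b + i)%N & (j <= b + a)%N].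
Proof.
move=> ha hb.
have Lfa i' : (a <= i')%N -> Lf p + tau1 q <= 2 ^+ i' * Lf0 t k.
  move=> ai; apply: (le_trans ha); rewrite mulrC.
  apply: ler_pM; [by rewrite exprn_ge0|exact: ltW|by rewrite ler_weXn2l// ler1n|].
  by have /andP[] := run_Lf0 hrun k.
have Lgb j' : (b <= j')%N -> Num.max (tau2 q) (mu t 0 * L_mu p s q t (mu t 0))
    <= 2 ^+ j' * Lg0 t k.
  move=> bj; apply: (le_trans hb); rewrite mulrC.
  apply: ler_pM; [by rewrite exprn_ge0|exact: ltW|by rewrite ler_weXn2l// ler1n|].
  by have /andP[] := run_Lg0 hrun k.
elim=> [|i' j' hr [ij jb ja] gpos|i' j' hr [ij jb ja] _ nacc].
- by split.
- have jb' : (j' < b)%N.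
    rewrite ltnNge; apply/negP => /Lgb; rewrite ge_max => /andP[_ hg].
    by have := trial_feasible hA hB hrun hr hg; rewrite leNgt gpos.
  by split; rewrite ?(leq_trans jb')// ?leq_addr// ltnW.
- have [bj|jb'] := leqP b j'; last first.
    by split; rewrite ?ltnS// (leq_trans jb')// leq_addr.
  have ia : (i' < a)%N.
    rewrite ltnNge; apply/negP => /Lfa hF; apply: nacc.
    exact: (trial_accepted hA hB hrun hr hF (Lgb _ bj)).
  by split; rewrite ?ltnS// ?addnS// (leq_ltn_trans jb)// ltn_add2l.
Qed.

Let A := Num.max 2 (2 * (Lf p + tau1 q) / Lcheck q).
Let B := Num.max 2 (Num.max (2 * tau2 q / Lcheck q)
   (2 * mu t 0 * L_mu p s q t (mu t 0) / Lcheck q)).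

(** [a] and [b] doublings suffice for the two thresholds, and [i <= j <= b + a]; both powers are
    therefore at most [2 ^+ a * 2 ^+ b], which the two maxima in [M_L] bound. *)
Lemma reached_step_le k i j : reached p s q t k i j ->
  2 ^+ i * Lf0 t k <= M_L p s q t /\ 2 ^+ j * Lg0 t k <= M_L p s q t.
Proof.
move=> hr.
have [a [ha aA]] := pow2_bracket ((Lf p + tau1 q) / Lcheck q).
have [b [hb bB]] := pow2_bracket
  (Num.max (tau2 q) (mu t 0 * L_mu p s q t (mu t 0)) / Lcheck q).
rewrite ler_pdivrMr// [_ * Lcheck q]mulrC in ha.
rewrite ler_pdivrMr// [_ * Lcheck q]mulrC in hb.
have [ij _ jab] := reached_bound ha hb hr.
have {}aA : 2 ^+ a <= A by rewrite /A -mulrA.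
have {}bB : 2 ^+ b <= B.
  apply: (le_trans bB); rewrite /B.
  rewrite maxr_pMl ?invr_ge0 ?(ltW Lc_gt0)// maxr_pMr// !mulrA.
  exact: lexx.
have jAB : 2 ^+ j <= A * B.
  rewrite (@le_trans _ _ (2 ^+ (b + a)))//; first by rewrite ler_weXn2l// ler1n.
  by rewrite exprD mulrC ler_pM// exprn_ge0.
have AB0 : 0 <= A * B by exact: (le_trans (exprn_ge0 _ (ler0n _ 2)) jAB).
have Lle n L : (n <= j)%N -> Lcheck q <= L <= Lhat q ->
    2 ^+ n * L <= M_L p s q t.
  move=> nj /andP[cL Lh]; rewrite /M_L -/A -/B -mulrA [leRHS]mulrC.
  apply: ler_pM => //; first by rewrite (le_trans _ cL)// ltW.
  by apply: le_trans jAB; rewrite ler_weXn2l// ler1n.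
split; apply: Lle => //; [exact: run_Lf0 hrun k|exact: run_Lg0 hrun k].
Qed.

(** In each bound one maximum supplies twice a threshold and the other is at least 2. These bounds
    control [Lf + L] and [m * L_mu + Lg] by [2 * M_L] in the residual. *)
Lemma M_L_ge : 4 * Lf p <= M_L p s q t /\
  4 * (mu t 0 * L_mu p s q t (mu t 0)) <= M_L p s q t.
Proof.
have A2 : 2 <= A by rewrite le_max lexx.
have B2 : 2 <= B by rewrite le_max lexx.
have AF : 2 * (Lf p + tau1 q) / Lcheck q <= A by rewrite le_max lexx orbT.
have BF : 2 * mu t 0 * L_mu p s q t (mu t 0) / Lcheck q <= B.
  by rewrite !le_max lexx !orbT.
rewrite ler_pdivrMr// in AF; rewrite ler_pdivrMr// in BF.
have A0 : 0 <= A by lra.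
have B0 : 0 <= B by lra.
have LA : Lcheck q * A <= Lhat q * A by rewrite ler_wpM2r// (run_Lhat hrun).
have hL : Lcheck q * A * B <= M_L p s q t by rewrite /M_L -/A -/B ler_wpM2r.
have LcA : 0 <= Lcheck q * A by rewrite mulr_ge0// ltW.
have h1 := ler_wpM2l LcA B2.
have LcB : 0 <= Lcheck q * B by rewrite mulr_ge0// ltW.
have h2 := ler_wpM2l LcB A2.
by split; have := tau1_gt0; lra.
Qed.

Lemma M_L_ge0 : 0 <= M_L p s q t.
Proof. have [h _] := M_L_ge; have := A_Lf_gt0 hA; lra. Qed.

Lemma norm_grad_obj_le x : Omega0 p x -> `|grad (obj p) x| <= M_f p.
Proof.
move=> xO; have [M [M0 OM]] := Omega0_norm_bounded hA.
apply: ub_le_sup; last by exists x.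
exists (`|grad (obj p) 0| + Lf p * M) => _ [y yO <-].
have L0 := ltW (A_Lf_gt0 hA).
have -> : grad (obj p) y = grad (obj p) 0 + (grad (obj p) y - grad (obj p) 0).
  by rewrite addrC subrK.
rewrite (le_trans (ler_normD _ _))// lerD2l.
rewrite (le_trans (grad_lipschitz _ _ L0 (A_obj_smooth hA)))// subr0 ler_wpM2l//.
exact: OM.
Qed.

Lemma norm_subdiff_P1_le x z : Omega0_hat p s q t x -> subdiff (P1 p) x z ->
  `|z| <= M_P1 p s q t.
Proof.
move=> xO xz; have [M [M0 OM]] := Omega0_hat_bounded hA hrun.
have [c hc] := subdiff_bounded M (A_P1_convex hA).
apply: ub_le_sup; last by exists z => //; exists x.
by exists c => _ [y [u uO uy] <-]; apply: hc uy; exact: OM.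
Qed.

Lemma norm_subdiff_P2_le x z : Omega0 p x -> subdiff (P2 p) x z -> `|z| <= M_P2 p.
Proof.
move=> xO xz; have [M [M0 OM]] := Omega0_norm_bounded hA.
have [c hc] := subdiff_bounded M (A_P2_convex hA).
apply: ub_le_sup; last by exists z => //; exists x.
by exists c => _ [y [u uO uy] <-]; apply: hc uy; exact: OM.
Qed.

(** The infimum is a lower bound once [psi] is bounded below: feasible points above the starting
    value are harmless, and the others lie in the bounded [Omega0], where the descent inequality
    from [y] to 0 controls [obj p]. *)
Lemma psi_opt_le x : feasible p x -> psi_opt p <= psi p x.
Proof.
move=> fx; apply: ge_inf; last by exists x.
have [M [M0 OM]] := Omega0_norm_bounded hA.
have [c1 hc1] := convex_bounded_below M (A_P1_convex hA).
have [c2 hc2] := convex_bounded_above M (A_P2_convex hA).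
pose c := obj p 0 - M_f p * M - Lf p / 2 * M ^+ 2 + c1 - c2.
exists (Num.min (psi p (start p)) c) => _ [y fy <-]; rewrite ge_min.
have [/ltW ->//|yx] := ltP (psi p (start p)) (psi p y).
have yO : Omega0 p y by [].
apply/orP; right; rewrite /psi /c.
have yM := OM y yO.
have := smooth_descent y (- y) (A_obj_smooth hA).
rewrite subrr normrN innerNr.
have h1 : - inner (grad (obj p) y) y <= M_f p * M.
  rewrite lerNl (le_trans _ (inner_ge _ _))// lerN2.
  by apply: ler_pM => //; exact: norm_grad_obj_le.
have h2 : Lf p / 2 * `|y| ^+ 2 <= Lf p / 2 * M ^+ 2.
  rewrite ler_wpM2l//; first by have := A_Lf_gt0 hA; lra.
  by rewrite ler_sqr ?nnegrE.
have := hc1 y yM; have := hc2 y yM; lra.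
Qed.

(** * Bound on the multipliers *)

Section multiplier_bound.
Variables (eta : R) (tb : nat).
Hypotheses (heta : eta_admissible p s eta) (htb : is_tbar s t eta tb).

Lemma c_0_gt0 : 0 < c_0 t tb.
Proof.
have pos n : (0 < n)%N -> 0 < mu t n.-1 / mu t n - 1.
  case: n => // n _ /=; have /andP[m0 m1] := run_mu hrun n.
  by rewrite subr_gt0 ltr_pdivlMr// mul1r.
rewrite /c_0 big_nat; elim/big_ind: _ => [|x y x0 y0|n /andP[n0 _]].
- exact: (pos 1%N).
- by rewrite lt_min x0.
- exact: pos.
Qed.

Lemma c_0_le n : (0 < n <= tb)%N -> c_0 t tb <= mu t n.-1 / mu t n - 1.
Proof.
move=> ntb; rewrite /c_0; apply: (@ge_bigmin_seq _ _ _ _ _ n) => //.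
by rewrite mem_index_iota ltnS.
Qed.

Let e2 := Num.min eta (Num.min (2 * alpha3 s * Lcheck q)
    (Num.min (- 2 * (mu t 0)^-1 * Lcheck q * g_smooth p s (mu t 0) (start p))
             (2 * c_0 t tb * alpha4 s * Lcheck q))).

Lemma eta_bar2_gt0 : 0 < e2.
Proof.
have [eta0 _] := heta.
have a3 := B_alpha3 hB; have a4 := B_alpha4 hB.
rewrite !lt_min eta0/=; apply/and3P; split.
- by rewrite !mulr_gt0.
- rewrite !mulNr oppr_gt0 pmulr_rlt0 ?(run_g0 hrun)//.
  by rewrite !mulr_gt0// invr_gt0 (mu_gt0 hrun).
- by rewrite !mulr_gt0 ?c_0_gt0.
Qed.

Lemma eta_bar_gt0 : 0 < eta_bar p s q t eta tb.
Proof. by rewrite sqrtr_gt0 eta_bar2_gt0. Qed.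

Lemma eta_bar_sqr : eta_bar p s q t eta tb ^+ 2 = e2.
Proof. by rewrite sqr_sqrtr// ltW// eta_bar2_gt0. Qed.

(* The four terms of the minimum defining [eta_bar] correspond to: [w] large; [k >= tb],
   where admissibility of [eta] bounds [g_mu] away from 0; [k = 0]; [0 < k < tb], where
   [g_mu] is negative because [mu] decreased. *)
Lemma eta_bar_le k L : Lcheck q <= L ->
  eta_bar p s q t eta tb ^+ 2 <=
    `|grad (g_smooth p s (mu t k)) (iterate t k)| ^+ 2
    - 2 * (L / mu t k) * g_smooth p s (mu t k) (iterate t k).
Proof.
move=> cL; rewrite eta_bar_sqr.
have [eta0 hadm] := heta; have [tb0 tbeta _] := htb.
have m0 := mu_gt0 hrun k; have gk := g_smooth_iterate hB hrun k.
have L0 : 0 < L := lt_le_trans Lc_gt0 cL.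
have Lm0 : 0 < L / mu t k by rewrite divr_gt0.
(* As [g_mu <= 0], the smallest step constant [Lcheck q] is the worst case. *)
have gneg : L / mu t k * g_smooth p s (mu t k) (iterate t k) <=
    Lcheck q / mu t k * g_smooth p s (mu t k) (iterate t k).
  by rewrite ler_wnM2r// ler_wpM2r ?invr_ge0 ?(ltW m0).
have Lcm0 : 0 < Lcheck q / mu t k by rewrite divr_gt0.
have wn := sqr_ge0 `|grad (g_smooth p s (mu t k)) (iterate t k)|.
have [wle|wlt] := leP eta (`|grad (g_smooth p s (mu t k)) (iterate t k)| ^+ 2).
  have : e2 <= eta by rewrite ge_min lexx.
  have : Lcheck q / mu t k * g_smooth p s (mu t k) (iterate t k) <= 0.
    by rewrite mulr_ge0_le0// ltW.
  by lra.
have [ktb|ktb] := ltnP k tb.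
  case: k ktb => [|k] ktb in m0 gk Lm0 gneg Lcm0 wn wlt *.
    have : e2 <= - 2 * (mu t 0)^-1 * Lcheck q * g_smooth p s (mu t 0) (start p).
      by rewrite !ge_min lexx !orbT.
    by rewrite -(run_start hrun); lra.
  have : e2 <= 2 * c_0 t tb * alpha4 s * Lcheck q by rewrite !ge_min lexx !orbT.
  have c0le : c_0 t tb <= mu t k / mu t k.+1 - 1 := c_0_le (n := k.+1) (ltnW ktb).
  have a4 := B_alpha4 hB.
  have h1 : 2 * c_0 t tb * alpha4 s * Lcheck q <=
      2 * (mu t k / mu t k.+1 - 1) * alpha4 s * Lcheck q.
    rewrite ler_wpM2r ?(ltW Lc_gt0)// ler_wpM2r ?(ltW a4)//.
    by rewrite ler_wpM2l.
  have h2 := ler_wpM2l (ltW Lcm0) (g_smooth_iterate_lt hB hrun k).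
  have h3 : Lcheck q / mu t k.+1 * (- alpha4 s * (mu t k - mu t k.+1)) =
    - ((mu t k / mu t k.+1 - 1) * alpha4 s * Lcheck q).
    by field; rewrite gt_eqF.
  by lra.
have a3 := B_alpha3 hB.
have : e2 <= 2 * alpha3 s * Lcheck q by rewrite !ge_min lexx !orbT.
set u := grad (hfam s (mu t k)) (cstr p (iterate t k)).
have uG : eta < - inner u (cstr p (iterate t k)).
  rewrite ltNge; apply/negP => hle; apply: hadm; exists (iterate t k), u; split => //.
  - exact: (iterate_Omega0 hA hB hrun).
  - exact: (grad_hfam_base hB).
  - by rewrite -grad_g_smooth// ltW.
have mk : mu t k < eta / (2 * alpha3 s) by apply: le_lt_trans tbeta; exact: (mu_le hrun).
rewrite ltr_pdivlMr ?mulr_gt0// in mk.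
(* [eta] exceeds twice [alpha3 s * mu t k] here: one copy pays for the smoothing error, the other
   remains as the margin. *)
have hG : g_smooth p s (mu t k) (iterate t k) <= - (alpha3 s * mu t k).
  by have := hfam_le_inner hB (cstr p (iterate t k)) m0; rewrite -/u /g_smooth; lra.
have h2 := ler_wpM2l (ltW Lcm0) hG.
have h3 : Lcheck q / mu t k * - (alpha3 s * mu t k) = - (alpha3 s * Lcheck q).
  by field; rewrite gt_eqF.
by lra.
Qed.

Lemma M_lambda_ge : (M_f p + M_P1 p s q t + M_P2 p) / eta_bar p s q t eta tb <=
  M_lambda p s q t eta tb.
Proof.
rewrite lerDl; have := eta_bar_gt0 => e0.
have m0 := ltW (mu_gt0 hrun 0); have c0 := ltW Lc_gt0.
apply: divr_ge0; last by apply: mulr_ge0; [apply: mulr_ge0|exact: sqr_ge0].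
apply: mulr_ge0 => //; apply: mulr_ge0; last exact: sqr_ge0.
by apply: mulr_ge0; [exact: M_L_ge0|exact: sqr_ge0].
Qed.

Lemma bounds_ge0 : 0 <= M_f p + M_P1 p s q t + M_P2 p.
Proof.
by rewrite !addr_ge0//; apply: sup_ge0 => _ [x _ <-].
Qed.

(* Stationarity is paired with [v := w + (L / m) d]: by complementarity [|v| >= eta_bar]
   and [inner d v >= 0]. *)
Lemma trial_mult_le k i j : reached p s q t k i j ->
  trial_mult t k i j <= M_lambda p s q t eta tb.
Proof.
move=> hr; apply: le_trans M_lambda_ge; have e0 := eta_bar_gt0.
have lam0 := trial_mult_ge0 hrun hr.
rewrite ler_pdivlMr//.
(* Complementarity makes the model constraint tight only for a nonzero multiplier. *)
have [->|lamN0] := eqVneq (trial_mult t k i j) 0.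
  by rewrite mul0r bounds_ge0.
set x := iterate t k; set z := trial t k i j; set lam := trial_mult t k i j.
pose d := z - x; pose m := mu t k.
set w := grad (g_smooth p s m) x; set L := 2 ^+ j * Lg0 t k.
set LF := 2 ^+ i * Lf0 t k.
pose v := w + (L / m) *: d.
have m0 : 0 < m := mu_gt0 hrun k.
have cL : Lcheck q <= L := Lcheck_le_Lg hrun k j.
have L0 : 0 < L := lt_le_trans Lc_gt0 cL.
have xO := iterate_Omega0 hA hB hrun k.
have hg : inner w d = - g_smooth p s m x - L / m / 2 * `|d| ^+ 2.
  have := trial_complementarity hrun hr; rewrite -/x -/z -/lam -/m -/w -/d -/L.
  move=> /eqP; rewrite mulf_eq0 (negbTE lamN0)/= => /eqP.
  have -> : L / (2 * m) = L / m / 2 by rewrite invfM mulrCA mulrC.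
  lra.
(* With [hg] the terms in the squared norm of [d] cancel, and the squared norm of [v] is exactly the
   quantity bounded below in [eta_bar_le]. *)
have vsq : eta_bar p s q t eta tb ^+ 2 <= `|v| ^+ 2.
  apply: (le_trans (eta_bar_le k cL)); rewrite -/x -/m -/w.
  rewrite normD_sqr normrZ exprMn innerZr hg real_normK ?num_real//; lra.
have ev : eta_bar p s q t eta tb <= `|v|.
  by rewrite -ler_sqr ?nnegrE// ltW.
have v0 : 0 < `|v| := lt_le_trans e0 ev.
rewrite (@le_trans _ _ (lam * `|v|))//; first by rewrite ler_wpM2l.
have dv : 0 <= inner d v.
  rewrite innerDr innerZr inner_norm innerC hg.
  have := g_smooth_iterate hB hrun k; rewrite -/x -/m.
  have : 0 <= L / m * `|d| ^+ 2 by rewrite mulr_ge0 ?sqr_ge0// divr_ge0// ltW.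
  lra.
pose b := grad (obj p) x - xi t k; pose a := - (b + LF *: d + lam *: v).
have ha : subdiff (P1 p) z a := trial_stationarity hA hrun hr.
have aP : `|a| <= M_P1 p s q t.
  apply: norm_subdiff_P1_le ha.
  exact: (sub_Omega0_hat xO (trial_dist_le hA hB hrun hr)).
have bP : `|b| <= M_f p + M_P2 p.
  rewrite (le_trans (ler_normB _ _))// lerD ?norm_grad_obj_le//.
  exact: (norm_subdiff_P2_le xO (run_xi hrun k)).
have vE : lam * `|v| ^+ 2 = - inner a v - inner b v - LF * inner d v.
  by rewrite /a innerNl (innerDl (b + _)) (innerDl b) !innerZl inner_norm; ring.
have LF0 : 0 <= LF * inner d v.
  by rewrite mulr_ge0// (le_trans (ltW Lc_gt0))// (Lcheck_le_LF hrun).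
have h1 : - inner a v <= `|a| * `|v| by rewrite lerNl inner_ge.
have h2 : - inner b v <= `|b| * `|v| by rewrite lerNl inner_ge.
rewrite -(ler_pM2r v0) -mulrA -expr2 vE.
have := ler_wpM2r (ltW v0) aP; have := ler_wpM2r (ltW v0) bP; lra.
Qed.

End multiplier_bound.
End estimates.

(** * Rates *)

Section selection.
Context {R : realType}.

Lemma exists_le_weighted_mean (a b : nat -> R) (n m : nat) (D : R) : (n < m)%N ->
  (forall k, 0 < b k) -> \sum_(n <= k < m) a k <= D ->
  exists2 k, (n <= k < m)%N & a k <= b k * (D / \sum_(n <= k < m) b k).
Proof.
move=> nm b0 aD; apply: contrapT => hn.
set S := \sum_(n <= k < m) b k in hn.
have S0 : 0 < S.
  rewrite /S big_ltn// ltr_pwDl//.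
  by apply: sumr_ge0 => i _; exact/ltW/b0.
have : \sum_(n <= k < m) b k * (D / S) < \sum_(n <= k < m) a k.
  apply: ltr_sum_nat => // k nkm; rewrite ltNge; apply/negP => ak.
  by apply: hn; exists k.
by rewrite -mulr_suml -/S mulrCA mulfV ?gt_eqF// mulr1 ltNge aD.
Qed.

Lemma sqrt_div (a S : R) : 0 <= a -> 0 <= S ->
  Num.sqrt (a / S) = Num.sqrt a / Num.sqrt S.
Proof. by move=> a0 S0; rewrite sqrtrM// sqrtrV. Qed.

Lemma edist_inf0_le (V : normedModType R) (A : set V) z r : A z -> `|z| <= r ->
  (edist_inf A 0%R <= r%:E)%E.
Proof.
move=> Az zr; apply: (@le_trans _ _ (edist (0 : V, z))).
  by apply: ereal_inf_lbound; exists z.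
apply/lee_addgt0Pr => e e0; rewrite -EFinD.
have r0 : 0 <= r by apply: le_trans zr.
apply: edist_fin; first by rewrite ltr_wpDl.
by rewrite -ball_normE /= sub0r normrN ltr_pwDr.
Qed.

(** With the subgradient of [P1] given by stationarity, [xi] cancels and only differences of
    gradients and multiples of the step remain. *)
Lemma residual_split (V : euclidType R) (a b xi d w g : V) (L l c : R) :
  - (a - xi + L *: d + l *: (w + c *: d)) - xi + b + l *: g =
  (b - a) - L *: d + (l *: (g - w) - (l * c) *: d).
Proof. by apply: inner_eq => v; rewrite !(innerDl, innerNl, innerZl); ring. Qed.

End selection.

Section rates.
Context {R : realType} {X Y : euclidType R}.
Context (p : problem X Y) (s : smoothing Y) (q : parameters R) (t : history X).
Hypotheses (hA : assumptionA p) (hB : assumptionB p s) (hrun : sMBA p s q t).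
Context (eta : R) (tb : nat).
Hypotheses (heta : eta_admissible p s eta) (htb : is_tbar s t eta tb).

Let tau1_gt0 := run_tau1 hrun.
Let tau2_gt0 := run_tau2 hrun.

Lemma mult_le_M_lambda k : mult t k.+1 <= M_lambda p s q t eta tb.
Proof.
rewrite (run_mult hrun).
exact: (trial_mult_le hA hB hrun heta htb (run_reached hrun k)).
Qed.

Lemma psi_gap_ge0 k : psi_opt p <= psi p (iterate t k).
Proof. by apply: psi_opt_le => //; case: (iterate_Omega0 hA hB hrun k). Qed.

(** The guaranteed decrease carries a factor [1 / mu t k]; with weights [mu t k], clearing it
    produces the [mu t k ^+ 2] that the squared residual bound is divided by. *)
Lemma exists_small_step K : exists2 k, (uphalf K <= k < K.+1)%N &
  (tau1 q * mu t k + tau2 q * mult t k.+1) * `|iterate t k.+1 - iterate t k| ^+ 2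
  <= 2 * mu t k ^+ 2 * ((psi p (start p) - psi_opt p) / muS t K).
Proof.
have KK : (uphalf K < K.+1)%N by rewrite ltnS leq_uphalf_double -addnn leq_addr.
have tel : \sum_(uphalf K <= k < K.+1) (psi p (iterate t k) - psi p (iterate t k.+1))
    <= psi p (start p) - psi_opt p.
  under eq_bigr do rewrite -opprB.
  rewrite sumrN telescope_sumr ?(ltnW KK)// opprB lerB ?psi_gap_ge0//.
  by have [] := iterate_Omega0 hA hB hrun (uphalf K).
have [k hk kle] := exists_le_weighted_mean KK (mu_gt0 hrun) tel.
exists k => //; have m0 := mu_gt0 hrun k.
have := psi_iterateS hrun k; set n2 := `|_ - _| ^+ 2; set c := tau1 q * _ + tau2 q * _ => h.
have {h}kle : c / (2 * mu t k) * n2 <=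
    mu t k * ((psi p (start p) - psi_opt p) / muS t K).
  by apply: le_trans kle; lra.
have m20 : 0 < 2 * mu t k by rewrite mulr_gt0.
have := ler_wpM2l (ltW m20) kle.
have -> : 2 * mu t k * (c / (2 * mu t k) * n2) = c * n2.
  by rewrite mulrA [2 * mu t k * _]mulrC divfK// gt_eqF.
by rewrite expr2 !mulrA.
Qed.

(** * Estimates at one iteration *)

Section step.
Variable k : nat.

Let x := iterate t k.
Let z := iterate t k.+1.
Let m := mu t k.
Let lam := mult t k.+1.
Let d := z - x.
Let w := grad (g_smooth p s m) x.
Let gz := grad (g_smooth p s m) z.
Let L := 2 ^+ ik t k * Lf0 t k.
Let Lg := 2 ^+ jk t k * Lg0 t k.
Let m_gt0 : 0 < m := mu_gt0 hrun k.
Let lam_ge0 : 0 <= lam := mult_ge0 hrun k.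
Let xd : x + d = z. Proof. by rewrite /d addrC subrK. Qed.
Let zO : Omega0 p z := iterate_Omega0 hA hB hrun k.+1.
Let x_hat := Omega0_sub_hat hrun (iterate_Omega0 hA hB hrun k).
Let z_hat := Omega0_sub_hat hrun zO.
Let LgM : L <= M_L p s q t /\ Lg <= M_L p s q t :=
  reached_step_le hA hB hrun (run_reached hrun k).

Let segment_le r v : 0 <= r <= 1 ->
  `|'d (cstr p) (x + r *: d) v| <= M_G_hat p s q t * `|v|.
Proof. by move=> r01; apply: diff_cstr_segment_le => //; rewrite xd. Qed.

Lemma grad_g_smooth_step_le : `|gz - w| <= L_mu p s q t m * `|d|.
Proof.
rewrite -L_muE expr2; apply: grad_g_smooth_lipschitz => //.
- exact: M_G_hat_ge0.
- by move=> v; have := @segment_le 1 v; rewrite scale1r xd; apply; rewrite ler01 lexx.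
- rewrite -[in cstr p z]xd; apply: mean_value_norm_le => [y|r r01].
    by case: (A_cstr_smooth hA).
  exact: segment_le.
Qed.

Lemma stationarity_step : subdiff (P1 p) z
  (- (grad (obj p) x - xi t k + L *: d + lam *: (w + (Lg / m) *: d))).
Proof.
have := trial_stationarity hA hrun (run_reached hrun k).
by rewrite -(run_iter hrun) -(run_mult hrun).
Qed.

(** A member of the set in [rho], built from the subgradient of [P1] at the new iterate that the
    subproblem provides and from [xi t k], a subgradient of [P2] at the old one. *)
Let residual : X := - (grad (obj p) x - xi t k + L *: d + lam *: (w + (Lg / m) *: d))
  - xi t k + grad (obj p) z + adjoint ('d (cstr p) z) (vdual p s t k.+1).

(** Multiplying by [m] clears the [1 / m] in both the model curvature and [L_mu]; the coefficients
    of [m] and of [lam] are then at most [2 * M_L]. *)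
Lemma residual_le : m * `|residual| <= 2 * M_L p s q t * (m + lam) * `|d|.
Proof.
have e : residual = (grad (obj p) z - grad (obj p) x) - L *: d
    + (lam *: (gz - w) - (lam * (Lg / m)) *: d).
  rewrite /residual /vdual adjointZ; last exact: linear_diff.
  by rewrite -grad_g_smooth// residual_split.
have h1 : `|residual| <= (Lf p + L + lam * (L_mu p s q t m + Lg / m)) * `|d|.
  have Lg0 : 0 <= Lg / m.
    rewrite divr_ge0 ?(ltW m_gt0)// (le_trans (ltW (run_Lcheck hrun)))//.
    exact: (Lcheck_le_Lg hrun).
  have L0 : 0 <= L.
    rewrite (le_trans (ltW (run_Lcheck hrun)))//; exact: (Lcheck_le_LF hrun).
  rewrite e (le_trans (ler_normD _ _))// mulrDl; apply: lerD.
    rewrite (le_trans (ler_normB _ _))// mulrDl; apply: lerD.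
      exact: (grad_lipschitz _ _ (ltW (A_Lf_gt0 hA)) (A_obj_smooth hA)).
    by rewrite normrZ ger0_norm.
  rewrite (le_trans (ler_normB _ _))// (normrZ lam) (normrZ (lam * _)).
  rewrite ger0_norm// [ `|lam * _|]ger0_norm ?(mulr_ge0 lam_ge0 Lg0)//.
  by have := ler_wpM2l lam_ge0 grad_g_smooth_step_le; lra.
have [LM LgM'] := LgM; have [fM muM] := M_L_ge hrun.
have mL := mul_L_mu_le q t hA hB m_gt0 (mu_le hrun (leq0n k)).
have M0 := M_L_ge0 hA hrun.
have c1 : m * (Lf p + L) <= 2 * M_L p s q t * m.
  by rewrite mulrC ler_wpM2r ?(ltW m_gt0)//; lra.
have c2 : m * (L_mu p s q t m + Lg / m) <= 2 * M_L p s q t.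
  rewrite mulrDr [m * (Lg / m)]mulrC divfK ?gt_eqF//.
  by rewrite -/m in mL; lra.
have h2 := ler_wpM2l (ltW m_gt0) h1.
apply: (le_trans h2); rewrite mulrA ler_wpM2r//.
have := ler_wpM2l lam_ge0 c2; lra.
Qed.

Section bounds_at_step.
Variable T : R.
Hypothesis small : (tau1 q * m + tau2 q * lam) * `|d| ^+ 2 <= 2 * m ^+ 2 * T.

Let n2_ge0 : 0 <= `|d| ^+ 2 := sqr_ge0 _.

Lemma mul_lam_sqr_le : tau2 q * (lam * `|d| ^+ 2) <= 2 * m ^+ 2 * T.
Proof.
apply: le_trans small; rewrite mulrA ler_wpM2r// lerDr.
by rewrite mulr_ge0// ltW.
Qed.

Lemma step_sqr_le : `|d| ^+ 2 <= 2 * m * T / tau1 q.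
Proof.
rewrite ler_pdivlMr// -(ler_pM2l m_gt0).
have : m * (`|d| ^+ 2 * tau1 q) <= (tau1 q * m + tau2 q * lam) * `|d| ^+ 2.
  have := mulr_ge0 (ltW tau2_gt0) (mulr_ge0 lam_ge0 n2_ge0); lra.
by move=> /le_trans/(_ small); rewrite expr2; lra.
Qed.

(** [mx] bounds [m / tau1] and [lam / tau2], so the quadratic [(m + lam) ^+ 2] is dominated by the
    linear weight of the decrease. The 16 in [M1_bar] is 4 from squaring [residual_le], 2 from [(m +
    lam) ^+ 2 <= 2 * (m ^+ 2 + lam ^+ 2)] and 2 from [small]. *)
Lemma residual_sqr_le : `|residual| ^+ 2 <= M1_bar p s q t eta tb * T.
Proof.
set mx := Num.max (mu t 0 / tau1 q) (M_lambda p s q t eta tb / tau2 q).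
have h1 : m ^+ 2 <= mx * (tau1 q * m).
  have : mu t 0 <= mx * tau1 q by rewrite -ler_pdivrMr// le_max lexx.
  move=> /(ler_wpM2r (ltW m_gt0)); have := mu_le hrun (leq0n k); rewrite -/m.
  move=> /(ler_wpM2r (ltW m_gt0)); rewrite expr2; lra.
have h2 : lam ^+ 2 <= mx * (tau2 q * lam).
  have : M_lambda p s q t eta tb <= mx * tau2 q.
    by rewrite -ler_pdivrMr// le_max lexx orbT.
  move=> /(ler_wpM2r lam_ge0); have := mult_le_M_lambda k; rewrite -/lam.
  move=> /(ler_wpM2r lam_ge0); rewrite expr2; lra.
have h3 : (m + lam) ^+ 2 <= 2 * mx * (tau1 q * m + tau2 q * lam).
  have := sqr_ge0 (m - lam); rewrite !expr2 in h1 h2 *; lra.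
have mx0 : 0 <= mx by rewrite le_max divr_ge0// ltW// (mu_gt0 hrun).
have h4 : (m + lam) ^+ 2 * `|d| ^+ 2 <= 4 * mx * m ^+ 2 * T.
  have a1 := ler_wpM2r n2_ge0 h3; have a2 := ler_wpM2l mx0 small; lra.
have M0 := M_L_ge0 hA hrun.
have := residual_le; rewrite -ler_sqr ?nnegrE; last 2 first.
- by rewrite mulr_ge0// ltW.
- apply: mulr_ge0 => //; apply: mulr_ge0; first exact: mulr_ge0.
  exact: (addr_ge0 (ltW m_gt0) lam_ge0).
rewrite (exprMn 2 m) (exprMn 2 (2 * _ * _)) (exprMn 2 (2 * M_L p s q t)) (exprMn 2 2) => h5.
have m2 : 0 < m ^+ 2 by rewrite exprn_gt0.
rewrite -(ler_pM2l m2) (le_trans h5)// /M1_bar -/mx.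
have := ler_wpM2l (sqr_ge0 (M_L p s q t)) h4; lra.
Qed.

(** Weighted by [lam], the model vanishes at [z], and [g_smooth_ge] compares it with [g_mu]; hence
    [- lam * g_mu] is at most of the order of [lam] times the squared step. The smoothing error
    gives the other term. *)
Lemma complementarity_le : - inner (cstr p z) (vdual p s t k.+1) <=
  alpha3 s * M_lambda p s q t eta tb * m + M2_bar p s q t * T * m.
Proof.
rewrite /vdual -/z -/lam innerZr.
have h1 := hfam_le_inner hB (cstr p z) m_gt0.
rewrite [inner _ (cstr p z)]innerC in h1.
have h2 : - (lam * inner (cstr p z) (grad (hfam s m) (cstr p z))) <=
    lam * (alpha3 s * m) - lam * g_smooth p s m z.
  by have := ler_wpM2l lam_ge0 h1; rewrite /g_smooth; lra.
have h3 := g_smooth_ge hA hB x d m_gt0; rewrite xd -/w in h3.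
have h4 := ler_wpM2l lam_ge0 h3.
have h5 := trial_complementarity hrun (run_reached hrun k).
rewrite -(run_iter hrun) -(run_mult hrun) -/x -/z -/m -/w -/lam -/Lg in h5.
have cE : Lg / (2 * m) = Lg / m / 2 by rewrite invfM mulrCA mulrC.
rewrite cE in h5.
have h6 : alpha3 s * m * lam <= alpha3 s * m * M_lambda p s q t eta tb.
  by rewrite ler_wpM2l ?mult_le_M_lambda// mulr_ge0// ltW// (B_alpha3 hB).
have h7 : lam * `|d| ^+ 2 / 2 <= m ^+ 2 * T / tau2 q.
  by rewrite ler_pdivlMr//; have := mul_lam_sqr_le; lra.
have [_ LgM'] := LgM.
have MLG : 0 <= M_B s * LG p by rewrite mulr_ge0 ?M_B_ge0// (A_LG_ge0 hA).
have T0 : 0 <= m ^+ 2 * T / tau2 q.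
  by apply: le_trans h7; rewrite divr_ge0// mulr_ge0.
(* The factor [mu t 0 / m >= 1] gives both terms the denominator [m], to match [M2_bar]. *)
have h8 : lam * `|d| ^+ 2 / 2 * (Lg / m + M_B s * LG p) <=
   m ^+ 2 * T / tau2 q * (M_L p s q t / m + mu t 0 / m * (M_B s * LG p)).
  apply: ler_pM => //.
  - by rewrite divr_ge0// mulr_ge0.
  - rewrite addr_ge0// divr_ge0 ?(ltW m_gt0)// (le_trans (ltW (run_Lcheck hrun)))//.
    exact: (Lcheck_le_Lg hrun).
  - apply: lerD; first by rewrite ler_wpM2r// invr_ge0 ltW.
    rewrite ler_peMl// ler_pdivlMr// mul1r; exact: (mu_le hrun).
have h9 : m ^+ 2 * T / tau2 q * (M_L p s q t / m + mu t 0 / m * (M_B s * LG p)) =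
   M2_bar p s q t * T * m.
  by rewrite /M2_bar; field; rewrite !gt_eqF.
rewrite h9 in h8; lra.
Qed.

End bounds_at_step.

Lemma rho_le T : (tau1 q * m + tau2 q * lam) * `|d| ^+ 2 <= 2 * m ^+ 2 * T ->
  (rho p s t k.+1 <= (Num.sqrt (M1_bar p s q t eta tb * T))%:E)%E.
Proof.
move=> small; have h : `|residual| <= Num.sqrt (M1_bar p s q t eta tb * T).
  by rewrite -[`|residual|]ger0_norm// -sqrtr_sqr ler_wsqrtr// residual_sqr_le.
move: h; apply: edist_inf0_le.
exists (- (grad (obj p) x - xi t k + L *: d + lam *: (w + (Lg / m) *: d))).
  exact: stationarity_step.
by exists (xi t k) => //; exact: (run_xi hrun k).
Qed.

End step.

End rates.

Unset Implicit Arguments.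
Set Strict Implicit.

Theorem theorem3p8 (R : realType) (X Y : euclidType R)
    (p : problem X Y) (s : smoothing Y) (q : parameters R) (t : history X)
    (eta : R) (tb : nat)
    (hA : assumptionA p) (hB : assumptionB p s) (hC : assumptionC t)
    (hrun : sMBA p s q t)
    (heta : eta_admissible p s eta) (htb : is_tbar s t eta tb) :
  (forall k, Kcone p (cstr p (iterate t k))) /\
  (forall k, polar (Kcone p) (vdual p s t k.+1)) /\
  (forall K : nat, exists k : nat,
    [/\ (uphalf K <= k <= K)%N,
        (rho p s t k.+1 <=
           (Num.sqrt (M1_bar p s q t eta tb * (psi p (start p) - psi_opt p))
            / Num.sqrt (muS t K))%:E)%E,
        `|iterate t k.+1 - iterate t k| <=
           Num.sqrt (2 * (psi p (start p) - psi_opt p) / tau1 q)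
           * Num.sqrt (mu t (uphalf K)) / Num.sqrt (muS t K) &
        - inner (cstr p (iterate t k.+1)) (vdual p s t k.+1) <=
           alpha3 s * M_lambda p s q t eta tb * mu t (uphalf K)
           + M2_bar p s q t * (psi p (start p) - psi_opt p)
             * mu t (uphalf K) / muS t K]).
Proof.
split; first by move=> k; case: (iterate_Omega0 hA hB hrun k).
split=> [k|K].
  rewrite /vdual; have u := base_polar hB
    (grad_hfam_base hB (cstr p (iterate t k.+1)) (mu_gt0 hrun k)).
  by move=> w /u uw; rewrite innerZl mulr_ge0_le0// (mult_ge0 hrun).
have [k kK small] := exists_small_step hA hB hrun K.
set D := psi p (start p) - psi_opt p in small *.
set S := muS t K in small *.
have D0 : 0 <= D by rewrite subr_ge0 -(run_start hrun) (psi_gap_ge0 hA hB hrun).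
have S0 : 0 <= S by apply: sumr_ge0 => i _; exact/ltW/(mu_gt0 hrun).
have DS0 : 0 <= D / S by exact: divr_ge0.
have [hk _] := andP kK.
have muk := mu_le hrun hk.
have t1 := run_tau1 hrun; have t2 := run_tau2 hrun.
(* The signs of [M_lambda] and [M2_bar] allow [mu t k] to be replaced by the larger
   [mu t (uphalf K)] at the end. *)
have ML0 : 0 <= M_lambda p s q t eta tb.
  exact: le_trans (mult_ge0 hrun 0) (mult_le_M_lambda hA hB hrun heta htb 0).
have M20 : 0 <= M2_bar p s q t.
  have mu0 := ltW (mu_gt0 hrun 0); have LG0 := A_LG_ge0 hA.
  have MB0 := M_B_ge0 s; have M0 := M_L_ge0 hA hrun.
  by apply: divr_ge0 (ltW t2); rewrite addr_ge0// !mulr_ge0.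
exists k; split => //.
- apply: (le_trans (rho_le hA hB hrun heta htb small)).
  rewrite lee_fin mulrA sqrt_div//.
  apply: mulr_ge0 => //; apply: mulr_ge0; last first.
    by rewrite le_max (divr_ge0 ML0 (ltW t2)) orbT.
  by apply: mulr_ge0 => //; exact: sqr_ge0.
- have mu0 := ltW (mu_gt0 hrun (uphalf K)).
  have c0 : 0 <= 2 * D / tau1 q by rewrite divr_ge0 ?(ltW t1)// mulr_ge0.
  rewrite -sqrtrM// -sqrt_div ?(mulr_ge0 c0 mu0)//.
  rewrite -[leLHS]ger0_norm// -sqrtr_sqr ler_wsqrtr//.
  apply: (le_trans (step_sqr_le hrun small)).
  have -> : 2 * mu t k * (D / S) / tau1 q = mu t k * (2 / tau1 q * (D / S)) by lra.
  have -> : 2 * D / tau1 q * mu t (uphalf K) / S =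
    mu t (uphalf K) * (2 / tau1 q * (D / S)) by lra.
  rewrite ler_wpM2r//; exact: (mulr_ge0 (divr_ge0 (ler0n _ 2) (ltW t1)) DS0).
- apply: (le_trans (complementarity_le hA hB hrun heta htb small)).
  have a3 := ltW (B_alpha3 hB).
  have -> : M2_bar p s q t * D * mu t (uphalf K) / S =
    M2_bar p s q t * (D / S) * mu t (uphalf K) by ring.
  apply: lerD; rewrite ler_wpM2l// ?(mulr_ge0 a3 ML0)//.
  by rewrite mulr_ge0.
Qed.
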